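(* Let $\mathsf{Ctx}$ be the category of contexts for a functional language $\mathbb{F}$, and let $(\mathbf{P}_n\colon\mathsf{Ctx}^{\mathrm{op}}\to\mathsf{BA})_{n\in\mathbb{N}}$ be a QA-stratified Boolean doctrine over $\mathsf{Ctx}$. Then there are a relational language $\mathbb{P}$ (a set of predicate symbols with arities), a theory $\mathcal{T}$ in the first-order language $(\mathbb{F},\mathbb{P})$, and an isomorphism of QA-stratified Boolean doctrines between $(\mathbf{P}_n)_{n\in\mathbb{N}}$ and $(\mathsf{LT}^{\mathcal{T}}_n)_{n\in\mathbb{N}}$.
   Context: $\mathbb{N}$ contains $0$. $\mathsf{BA}$ is the category of Boolean algebras and Boolean homomorphisms. QA-one-step Boolean doctrine over a category $\mathsf{C}$ with finite products: a componentwise injective natural transformation $i\colon\mathbf{P}_0\hookrightarrow\mathbf{P}_1$ between functors $\mathbf{P}_0,\mathbf{P}_1\colon\mathsf{C}^{\mathrm{op}}\to\mathsf{BA}$ such that: (1) for all $X,Y\in\mathsf{C}$ and $\beta\in\mathbf{P}_0(X\times Y)$ there is a (necessarily unique) element $(\forall Y)_X\beta\in\mathbf{P}_1(X)$ such that for all $\alpha\in\mathbf{P}_1(X)$: $\alpha\le(\forall Y)_X\beta$ iff $\mathbf{P}_1(\mathrm{pr}_1)(\alpha)\le i_{X\times Y}(\beta)$, where $\mathrm{pr}_1\colon X\times Y\to X$; (2) for every $f\colon X'\to X$ and every $Y$, $\mathbf{P}_1(f)\circ(\forall Y)_X=(\forall Y)_{X'}\circ\mathbf{P}_0(f\times\mathrm{id}_Y)$;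 (3) for all $X$, the Boolean algebra $\mathbf{P}_1(X)$ is generated by the union over $Y\in\mathsf{C}$ of the images of $(\forall Y)_X\colon\mathbf{P}_0(X\times Y)\to\mathbf{P}_1(X)$. QA-stratified Boolean doctrine over $\mathsf{C}$: a sequence of functors $(\mathbf{P}_n\colon\mathsf{C}^{\mathrm{op}}\to\mathsf{BA})_{n\in\mathbb{N}}$ and QA-one-step Boolean doctrines $(i_n\colon\mathbf{P}_n\hookrightarrow\mathbf{P}_{n+1})_{n\in\mathbb{N}}$, with one-step quantifiers $(\forall Y)_{X,n}\colon\mathbf{P}_n(X\times Y)\to\mathbf{P}_{n+1}(X)$, such that $(i_{n+1})_X\circ(\forall Y)_{X,n}=(\forall Y)_{X,n+1}\circ(i_n)_{X\times Y}$ for all $X,Y,n$. Morphism of QA-stratified Boolean doctrines from $(\mathbf{P}_n)_n$ over $\mathsf{C}$ to $(\mathbf{R}_n)_n$ over $\mathsf{D}$: a finite-product-preserving functor $M\colon\mathsf{C}\to\mathsf{D}$ and natural transformations $\mathfrak{m}_n\colon\mathbf{P}_n\to\mathbf{R}_n\circ M^{\mathrm{op}}$ ($n\in\mathbb{N}$) that commute with the injections $i_n$ and satisfy $(\mathfrak{m}_{n+1})_X\circ(\forall Y)_{X,n}=(\forall M(Y))_{M(X),n}\circ(\mathfrak{m}_n)_{X\times Y}$ for all $X,Y,n$. Syntax. A first-order language $(\mathbb{F},\mathbb{P})$ (without equality) has function symbols $\mathbb{F}$ and predicate symbols $\mathbb{P}$. Formulas are considered up to renaming of bound variables. A context is a finite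 list of distinct variables; $\alpha:\vec x$ means that the free variables of $\alpha$ are among $\vec x$. A theory is a set of closed formulas. $\mathsf{Ctx}$, the category of contexts for $\mathbb{F}$, has contexts as objects; a morphism $(x_1,\dots,x_n)\to(y_1,\dots,y_m)$ is an $m$-tuple of $\mathbb{F}$-terms with variables among $\vec x$; composition is simultaneous substitution. It has finite products (concatenation of contexts after renaming; the terminal object is the empty list $()$). Provability: sequents $\Gamma\Rightarrow_{\vec y}\Delta$ carry a context $\vec y$, with $\Gamma,\Delta$ finite lists of formulas in context $\vec y$. The rules are those of the classical sequent calculus (identity, weakening, contraction, exchange, cut, left/right rules for $\top,\bot,\land,\lor,\lnot,\to$), all within one fixed context, together with: context enlargement (from $\Gamma\Rightarrow_{\vec y}\Delta$ infer $\Gamma\Rightarrow_{(\vec y,x)}\Delta$, $x\notin\vec y$); (L$\forall$) from $\zeta[t/x],\Gamma\Rightarrow_{\vec y}\Delta$ infer $\forall x\,\zeta,\Gamma\Rightarrow_{\vec y}\Delta$, where $t$ is a term with variables in $\vec y$; (R$\forall$) from $\Gamma\Rightarrow_{(\vec y,x)}\Delta,\zeta$ infer $\Gamma\Rightarrow_{\vec y}\Delta,\forall x\,\zeta$, where $\Gamma,\Delta$ are in context $\vec y$ and $x\notin\vec y$; and the dual rules (L$\exists$), (R$\exists$). (So the empty structure is admitted as a model.) A sequent is provable from $\mathcal{T}$ if it is derivable with additional axioms $\Rightarrow_{()}\varphi$ for $\varphi\in\mathcal{T}$. The syntactic doctrine $\mathsf{LT}^{\mathcal{T}}\colon\mathsf{Ctx}^{\mathrm{op}}\to\mathsf{BA}$: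 $\mathsf{LT}^{\mathcal{T}}(\vec x)$ is the poset reflection of the set of formulas in context $\vec x$ preordered by: $\alpha$ below $\beta$ iff $\alpha\Rightarrow_{\vec x}\beta$ is provable from $\mathcal{T}$; reindexing is substitution. $\mathsf{LT}^{\mathcal{T}}_0(\vec x)\subseteq\mathsf{LT}^{\mathcal{T}}(\vec x)$ is the set of equivalence classes of quantifier-free formulas in context $\vec x$; $\mathsf{LT}^{\mathcal{T}}_{n+1}(\vec x)$ is the Boolean subalgebra of $\mathsf{LT}^{\mathcal{T}}(\vec x)$ generated by the elements $\forall\vec y\,\alpha(\vec x,\vec y)$ with $\vec y$ ranging over contexts (disjoint from $\vec x$) and $\alpha\in\mathsf{LT}^{\mathcal{T}}_n(\vec x,\vec y)$. Each $\mathsf{LT}^{\mathcal{T}}_n$ is a subfunctor of $\mathsf{LT}^{\mathcal{T}}$, and $(\mathsf{LT}^{\mathcal{T}}_n)_n$ with the inclusions and the restrictions of $\forall\vec y$ is a QA-stratified Boolean doctrine. *)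

(* Defs.v *)
From HB Require Import structures.
From mathcomp Require Import all_boot all_order.
From mathcomp Require Import generic_quotient boolp.

Set Implicit Arguments.
Unset Strict Implicit.
Unset Printing Implicit Defensive.

Import Order.Theory.

Local Open Scope order_scope.

Record boolAlg := BoolAlg {
  ba_disp : Order.disp_t;
  ba_sort :> ctbDistrLatticeType ba_disp }.

(* The library's {tblmorphism A -> B} only preserves \bot and \top. *)
Record bool_hom (A B : boolAlg) := BoolHom {
  bh_fun :> A -> B;
  bhI : {morph bh_fun : x y / x `&` y};
  bhU : {morph bh_fun : x y / x `|` y};
  bhC : {morph bh_fun : x / ~` x};
  bh0 : bh_fun \bot = \bot;
  bh1 : bh_fun \top = \top }.

Lemma bool_hom_ext (A B : boolAlg) (f g : bool_hom A B) : f =1 g -> f = g.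
Proof.
case: f g => f f1 f2 f3 f4 f5 [g g1 g2 g3 g4 g5] /= /funext fg.
by case: _ / fg in g1 g2 g3 g4 g5 *; congr BoolHom; apply: Prop_irrelevance.
Qed.

Definition bool_hom_id (A : boolAlg) : bool_hom A A.
Proof. by exists id. Defined.

Definition bool_hom_comp (A B C : boolAlg) (g : bool_hom B C)
  (f : bool_hom A B) : bool_hom A C.
Proof.
by exists (fun x => g (f x)) => [x y|x y|x||];
  rewrite ?bhI ?bhU ?bhC ?bh0 ?bh1.
Defined.

Section Generation.
Context {d : Order.disp_t} {A : ctbDistrLatticeType d}.

Inductive generated (S : A -> Prop) : A -> Prop :=
| gen_in a of S a : generated S a
| gen_top : generated S \top
| gen_bot : generated S \bot
| gen_meet a b of generated S a & generated S b : generated S (a `&` b)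
| gen_join a b of generated S a & generated S b : generated S (a `|` b)
| gen_compl a of generated S a : generated S (~` a).
End Generation.

Record fpcat := FPCat {
  Ob :> Type;
  Hom : Ob -> Ob -> Type;
  idm : forall X, Hom X X;
  cmp : forall X Y Z, Hom Y Z -> Hom X Y -> Hom X Z;
  cmp1m : forall X Y (f : Hom X Y), cmp (idm Y) f = f;
  cmpm1 : forall X Y (f : Hom X Y), cmp f (idm X) = f;
  cmpA : forall X Y Z W (h : Hom Z W) (g : Hom Y Z) (f : Hom X Y),
    cmp h (cmp g f) = cmp (cmp h g) f;
  one : Ob;
  bang : forall X, Hom X one;
  bangP : forall X (f : Hom X one), f = bang X;
  prd : Ob -> Ob -> Ob;
  pr1 : forall X Y, Hom (prd X Y) X;
  pr2 : forall X Y, Hom (prd X Y) Y;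
  pairing : forall X Y Z, Hom Z X -> Hom Z Y -> Hom Z (prd X Y);
  pr1_pair : forall X Y Z (f : Hom Z X) (g : Hom Z Y), cmp (pr1 X Y) (pairing f g) = f;
  pr2_pair : forall X Y Z (f : Hom Z X) (g : Hom Z Y), cmp (pr2 X Y) (pairing f g) = g;
  pair_uniq : forall X Y Z (h : Hom Z (prd X Y)),
    h = pairing (cmp (pr1 X Y) h) (cmp (pr2 X Y) h) }.

Arguments idm {f0} X : rename.
Arguments cmp {f0 X Y Z} : rename.
Arguments bang {f0} X : rename.
Arguments prd {f0} : rename.
Arguments pr1 {f0} X Y : rename.
Arguments pr2 {f0} X Y : rename.
Arguments pairing {f0 X Y Z} : rename.

Notation "g ∘ f" := (cmp g f) (at level 40, left associativity).
Notation "X ⊗ Y" := (prd X Y) (at level 40, left associativity).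

Section Category.
Context {C : fpcat}.

Definition times_id (X' X : C) (f : Hom X' X) (Y : C) : Hom (X' ⊗ Y) (X ⊗ Y) :=
  pairing (f ∘ pr1 X' Y) (pr2 X' Y).

Definition is_iso (X Y : C) (f : Hom X Y) : Prop :=
  exists g : Hom Y X, g ∘ f = idm X /\ f ∘ g = idm Y.

Lemma pair_cmp (X Y Z W : C) (f : Hom Z X) (g : Hom Z Y) (h : Hom W Z) :
  pairing f g ∘ h = pairing (f ∘ h) (g ∘ h).
Proof. by rewrite [LHS]pair_uniq !cmpA pr1_pair pr2_pair. Qed.

Lemma pair_pr (X Y : C) : pairing (pr1 X Y) (pr2 X Y) = idm (X ⊗ Y).
Proof. by rewrite [RHS]pair_uniq !cmpm1. Qed.

Lemma is_iso_id (X : C) : is_iso (idm X).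
Proof. by exists (idm X); rewrite !cmp1m. Qed.

Lemma is_iso_cmp (X Y Z : C) (g : Hom Y Z) (f : Hom X Y) :
  is_iso g -> is_iso f -> is_iso (g ∘ f).
Proof.
move=> [g' [g'g gg']] [f' [f'f ff']]; exists (f' ∘ g'); split.
  by rewrite -cmpA [g' ∘ _]cmpA g'g cmp1m f'f.
by rewrite -cmpA [f ∘ _]cmpA ff' cmp1m gg'.
Qed.
End Category.

(* Finite products are preserved up to isomorphism, not on the nose.          *)
Record fp_functor (C D : fpcat) := FPFunctor {
  fob :> C -> D;
  fmap : forall X Y, Hom X Y -> Hom (fob X) (fob Y);
  fmap_id : forall X, fmap (idm X) = idm (fob X);
  fmap_cmp : forall X Y Z (g : Hom Y Z) (f : Hom X Y),
    fmap (g ∘ f) = fmap g ∘ fmap f;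
  fmap_prd : forall X Y, is_iso (pairing (fmap (pr1 X Y)) (fmap (pr2 X Y)));
  fmap_one : is_iso (bang (fob (one C))) }.

Arguments fmap {C D} f {X Y} : rename.

Definition comparison (C D : fpcat) (M : fp_functor C D) (X Y : C) :
  Hom (M (X ⊗ Y)) (M X ⊗ M Y) := pairing (fmap M (pr1 X Y)) (fmap M (pr2 X Y)).

Definition fp_functor_id (C : fpcat) : fp_functor C C.
Proof.
exists id (fun _ _ f => f) => // [X Y|].
  by rewrite pair_pr; apply: is_iso_id.
by rewrite -(bangP (idm _)); apply: is_iso_id.
Defined.

Lemma fmap_iso (C D : fpcat) (M : fp_functor C D) (X Y : C) (f : Hom X Y) :
  is_iso f -> is_iso (fmap M f).
Proof. by move=> [g [gf fg]]; exists (fmap M g); rewrite -!fmap_cmp gf fg !fmap_id. Qed.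

Definition fp_functor_comp (C D E : fpcat) (N : fp_functor D E)
  (M : fp_functor C D) : fp_functor C E.
Proof.
exists (fun X => N (M X)) (fun _ _ f => fmap N (fmap M f)).
- by move=> X; rewrite !fmap_id.
- by move=> *; rewrite !fmap_cmp.
- move=> X Y.
  have -> : pairing (fmap N (fmap M (pr1 X Y))) (fmap N (fmap M (pr2 X Y))) =
            comparison N (M X) (M Y) ∘ fmap N (comparison M X Y).
    by rewrite pair_cmp -!fmap_cmp pr1_pair pr2_pair.
  by apply: is_iso_cmp; [apply: fmap_prd | apply/fmap_iso/fmap_prd].
- rewrite -(bangP (bang (N (one D)) ∘ fmap N (bang (M (one C))))).
  by apply: is_iso_cmp; [apply: fmap_one | apply/fmap_iso/fmap_one].
Defined.

Record doctrine (C : fpcat) := Doctrine {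
  dob :> C -> boolAlg;
  dmap : forall X Y, Hom X Y -> bool_hom (dob Y) (dob X);
  dmap_id : forall X (a : dob X), dmap (idm X) a = a;
  dmap_cmp : forall X Y Z (g : Hom Y Z) (f : Hom X Y) (a : dob Z),
    dmap (g ∘ f) a = dmap f (dmap g a) }.

Arguments dmap {C} d {X Y} : rename.

Record nat_trans (C : fpcat) (P R : doctrine C) := NatTrans {
  nt_fun :> forall X, bool_hom (P X) (R X);
  nt_nat : forall X Y (f : Hom X Y) (a : P Y),
    nt_fun X (dmap P f a) = dmap R f (nt_fun Y a) }.

Definition precomp (C D : fpcat) (R : doctrine D) (M : fp_functor C D) : doctrine C.
Proof.
exists (fun X => R (M X)) (fun X Y f => dmap R (fmap M f)) => [X a|X Y Z g f a].
  by rewrite fmap_id dmap_id.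
by rewrite fmap_cmp dmap_cmp.
Defined.

(* qall is determined by qallP.                                               *)
Record qa_one_step (C : fpcat) (P0 P1 : doctrine C) := QAOneStep {
  incl :> nat_trans P0 P1;
  incl_inj : forall X, injective (incl X);
  qall : forall X Y : C, P0 (X ⊗ Y) -> P1 X;
  qallP : forall (X Y : C) (b : P0 (X ⊗ Y)) (a : P1 X),
    (a <= qall b) = (dmap P1 (pr1 X Y) a <= incl (X ⊗ Y) b);
  qall_BC : forall (X' X : C) (f : Hom X' X) (Y : C) (b : P0 (X ⊗ Y)),
    dmap P1 f (qall b) = qall (dmap P0 (times_id f Y) b);
  qall_gen : forall (X : C) (a : P1 X),
    generated (fun c => exists (Y : C) (b : P0 (X ⊗ Y)), c = qall b) a }.

Arguments qall {C P0 P1} q {X Y} : rename.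

Record qa_stratified (C : fpcat) := QAStratified {
  layer :> nat -> doctrine C;
  step : forall n, qa_one_step (layer n) (layer n.+1);
  step_qall : forall n (X Y : C) (b : layer n (X ⊗ Y)),
    step n.+1 X (qall (step n) b) = qall (step n.+1) (step n (X ⊗ Y) b) }.

Arguments step {C} q n : rename.

(* In qm_qall, c is the element of R n (M X ⊗ M Y) corresponding to the image *)
(* of b in R n (M (X ⊗ Y)) under the isomorphism M (X ⊗ Y) -> M X ⊗ M Y.      *)
Record qa_morphism (C D : fpcat) (P : qa_stratified C) (R : qa_stratified D) :=
  QAMorphism {
  qm_fun :> fp_functor C D;
  qm_nat : forall n, nat_trans (P n) (precomp (R n) qm_fun);
  qm_incl : forall n X (a : P n X),
    qm_nat n.+1 X (step P n X a) = step R n (qm_fun X) (qm_nat n X a);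
  qm_qall : forall n X Y (b : P n (X ⊗ Y)) (c : R n (qm_fun X ⊗ qm_fun Y)),
    dmap (R n) (comparison qm_fun X Y) c = qm_nat n (X ⊗ Y) b ->
    qm_nat n.+1 X (qall (step P n) b) = qall (step R n) c }.

Arguments qm_nat {C D P R} q n : rename.

Definition qa_id (C : fpcat) (P : qa_stratified C) : qa_morphism P P.
Proof.
exists (fp_functor_id C) (fun n => @NatTrans _ (P n) (precomp (P n) (fp_functor_id C))
  (fun X => bool_hom_id _) (fun _ _ _ _ => erefl)) => // n X Y b c /= <-.
by rewrite /comparison /= pair_pr dmap_id.
Defined.

Definition qa_comp (C D E : fpcat) (P : qa_stratified C) (R : qa_stratified D)
  (S : qa_stratified E) (N : qa_morphism R S) (M : qa_morphism P R) :
  qa_morphism P S.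
Proof.
unshelve eexists (fp_functor_comp N M) (fun n => @NatTrans _ (P n) (precomp (S n) (fp_functor_comp N M))
  (fun X => bool_hom_comp (qm_nat N n (M X)) (qm_nat M n X)) _).
- by move=> X Y f a; rewrite /= nt_nat /= nt_nat.
- by move=> n X a; rewrite /= qm_incl qm_incl.
move=> n X Y b c /=.
have -> : comparison (fp_functor_comp N M) X Y =
          comparison N (M X) (M Y) ∘ fmap N (comparison M X Y).
  by rewrite pair_cmp -!fmap_cmp pr1_pair pr2_pair.
rewrite dmap_cmp => cE.
have [k [kl lk]] := fmap_prd M X Y.
have bE : dmap (R n) (comparison M X Y) (dmap (R n) k (qm_nat M n (X ⊗ Y) b))
          = qm_nat M n (X ⊗ Y) b.
  by rewrite -dmap_cmp kl dmap_id.
rewrite (qm_qall bE); apply: qm_qall.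
transitivity (dmap (S n) (fmap N k) (qm_nat N n _ (qm_nat M n _ b))).
  by rewrite -cE -dmap_cmp -fmap_cmp lk fmap_id dmap_id.
by have /= <- := nt_nat (qm_nat N n) k.
Defined.

Definition qa_iso (C D : fpcat) (P : qa_stratified C) (R : qa_stratified D)
    (M : qa_morphism P R) : Prop :=
  exists N : qa_morphism R P, qa_comp N M = qa_id P /\ qa_comp M N = qa_id R.

Record language := Language {
  symbol :> Type;
  arity : symbol -> nat }.

Section Terms.
Context {F : language}.

(* In a context of length n the i-th variable is denoted by i : 'I_n.         *)
Inductive term (n : nat) : Type :=
| Var of 'I_n
| App (f : F) of ('I_(arity f) -> term n).

Fixpoint tsub n m (s : 'I_n -> term m) (t : term n) : term m :=
  match t with
  | Var i => s i
  | App f ts => App (fun k => tsub s (ts k))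
  end.

Lemma tsub_var n (t : term n) : tsub (@Var n) t = t.
Proof. by elim: t => //= f ts IH; congr App; apply: funext. Qed.

Lemma tsub_tsub n m p (s : 'I_n -> term m) (u : 'I_m -> term p) t :
  tsub u (tsub s t) = tsub (fun i => tsub u (s i)) t.
Proof. by elim: t => //= f ts IH; congr App; apply: funext. Qed.

Definition wkv n (i : 'I_n) : term n.+1 := Var (lift ord_max i).

Definition scons n m (t : term m) (s : 'I_n -> term m) (i : 'I_n.+1) : term m :=
  if unlift ord_max i is Some j then s j else t.

Definition up n m (s : 'I_n -> term m) : 'I_n.+1 -> term m.+1 :=
  scons (Var ord_max) (fun i => tsub (@wkv m) (s i)).

Definition castv n m (e : n = m) (i : 'I_n) : term m := Var (cast_ord e i).

Lemma scons_last n m t (s : 'I_n -> term m) : scons t s ord_max = t.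
Proof. by rewrite /scons unlift_none. Qed.

Lemma scons_lift n m t (s : 'I_n -> term m) i : scons t s (lift ord_max i) = s i.
Proof. by rewrite /scons liftK. Qed.

Lemma scons_eq n m t (s u : 'I_n.+1 -> term m) :
  s ord_max = t -> u ord_max = t ->
  (forall i, s (lift ord_max i) = u (lift ord_max i)) -> s = u.
Proof. by move=> s0 u0 su; apply/funext => i; case: (unliftP ord_max i) => [j ->|->]; rewrite ?su ?s0. Qed.

Lemma up_var n : up (@Var n) = @Var n.+1.
Proof. by apply: (scons_eq (scons_last _ _)) => // i; rewrite scons_lift. Qed.

Lemma up_up n m p (s : 'I_n -> term m) (u : 'I_m -> term p) :
  (fun i => tsub (up u) (up s i)) = up (fun i => tsub u (s i)).
Proof.
apply: (scons_eq (t := Var ord_max)); rewrite /up ?scons_last //= ?scons_last //.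
move=> i; rewrite !scons_lift !tsub_tsub; congr tsub.
by apply: funext => j /=; rewrite scons_lift.
Qed.
End Terms.

Arguments term F n : clear implicits.

Section Formulas.
Context {F R : language}.

(* The quantifiers bind the last variable of the extended context. *)
Inductive formula : nat -> Type :=
| Rel n (r : R) of ('I_(arity r) -> term F n) : formula n
| Top n : formula n
| Bot n : formula n
| And n of formula n & formula n : formula n
| Or n of formula n & formula n : formula n
| Neg n of formula n : formula n
| Imp n of formula n & formula n : formula n
| All n of formula n.+1 : formula n
| Ex n of formula n.+1 : formula n.

Fixpoint fsub n m (s : 'I_n -> term F m) (a : formula n) : formula m :=
  match a in formula n return ('I_n -> term F m) -> formula m with
  | Rel n r ts => fun s => Rel (fun k => tsub s (ts k))
  | Top n => fun=> Top m
  | Bot n => fun=> Bot m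
  | And n a b => fun s => And (fsub s a) (fsub s b)
  | Or n a b => fun s => Or (fsub s a) (fsub s b)
  | Neg n a => fun s => Neg (fsub s a)
  | Imp n a b => fun s => Imp (fsub s a) (fsub s b)
  | All n a => fun s => All (fsub (up s) a)
  | Ex n a => fun s => Ex (fsub (up s) a)
  end s.

Lemma fsub_var n (a : formula n) : fsub (@Var F n) a = a.
Proof.
elim: a => //= {n} [n r ts|n a -> b ->|n a -> b ->|n a ->|n a -> b ->|n a|n a] //.
- by congr Rel; apply: funext => k; rewrite tsub_var.
- by rewrite up_var => ->.
- by rewrite up_var => ->.
Qed.

Lemma fsub_fsub n m p (s : 'I_n -> term F m) (u : 'I_m -> term F p) a :
  fsub u (fsub s a) = fsub (fun i => tsub u (s i)) a.
Proof.
elim: a m p s u => //= {n}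
  [n r ts|n a IHa b IHb|n a IHa b IHb|n a IHa|n a IHa b IHb|n a IHa|n a IHa] m p s u;
  rewrite ?IHa ?IHb ?up_up //.
by congr Rel; apply: funext => k; rewrite tsub_tsub.
Qed.

Lemma fsub_id n (s : 'I_n -> term F n) a : s =1 @Var F n -> fsub s a = a.
Proof. by move=> /funext ->; apply: fsub_var. Qed.

Definition weaken n : formula n -> formula n.+1 := fsub (@wkv F n).

(* a[t/x], for x the last variable of the context of a *)
Definition inst n (t : term F n) : formula n.+1 -> formula n :=
  fsub (scons t (@Var F n)).

Fixpoint qfree n (a : formula n) : bool :=
  match a with
  | Rel _ _ _ | Top _ | Bot _ => true
  | And _ a b | Or _ a b | Imp _ a b => qfree a && qfree b
  | Neg _ a => qfree a
  | All _ _ | Ex _ _ => false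
  end.

Lemma qfree_fsub n m (s : 'I_n -> term F m) a : qfree (fsub s a) = qfree a.
Proof. by elim: a m s => //= {n} n a IHa b IHb m s; rewrite IHa IHb. Qed.

Fixpoint all_block n m : formula (n + m) -> formula n :=
  match m with
  | 0 => fsub (castv (addn0 n))
  | k.+1 => fun a => all_block (All (fsub (castv (addnS n k)) a))
  end.

Definition theory := formula 0 -> Prop.

(* provable T (n := n) G D: derivability from T of the sequent G => D in a    *)
(* context of length n; the active formulas are at the head on both sides.    *)
(* Contexts only grow by p_context, so empty structures are not excluded.     *)
Inductive provable (T : theory) : forall n, seq (formula n) -> seq (formula n) -> Prop :=
| p_axiom a of T a : provable T [::] [:: a]
| p_id n (a : formula n) : provable T [:: a] [:: a]
| p_weakL n a (G D : seq (formula n)) of provable T G D : provable T (a :: G) D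
| p_weakR n a (G D : seq (formula n)) of provable T G D : provable T G (a :: D)
| p_contrL n a (G D : seq (formula n)) of
    provable T (a :: a :: G) D : provable T (a :: G) D
| p_contrR n a (G D : seq (formula n)) of
    provable T G (a :: a :: D) : provable T G (a :: D)
| p_exchL n a b (G G' D : seq (formula n)) of
    provable T (G ++ a :: b :: G') D : provable T (G ++ b :: a :: G') D
| p_exchR n a b (G D D' : seq (formula n)) of
    provable T G (D ++ a :: b :: D') : provable T G (D ++ b :: a :: D')
| p_cut n a (G G' D D' : seq (formula n)) of
    provable T G (a :: D) & provable T (a :: G') D' :
    provable T (G ++ G') (D ++ D')
| p_topL n (G D : seq (formula n)) of provable T G D : provable T (Top n :: G) D
| p_topR n (G D : seq (formula n)) : provable T G (Top n :: D)
| p_botL n (G D : seq (formula n)) : provable T (Bot n :: G) D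
| p_botR n (G D : seq (formula n)) of provable T G D : provable T G (Bot n :: D)
| p_andL1 n a b (G D : seq (formula n)) of
    provable T (a :: G) D : provable T (And a b :: G) D
| p_andL2 n a b (G D : seq (formula n)) of
    provable T (b :: G) D : provable T (And a b :: G) D
| p_andR n a b (G D : seq (formula n)) of
    provable T G (a :: D) & provable T G (b :: D) : provable T G (And a b :: D)
| p_orL n a b (G D : seq (formula n)) of
    provable T (a :: G) D & provable T (b :: G) D : provable T (Or a b :: G) D
| p_orR1 n a b (G D : seq (formula n)) of
    provable T G (a :: D) : provable T G (Or a b :: D)
| p_orR2 n a b (G D : seq (formula n)) of
    provable T G (b :: D) : provable T G (Or a b :: D)
| p_negL n a (G D : seq (formula n)) of
    provable T G (a :: D) : provable T (Neg a :: G) D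
| p_negR n a (G D : seq (formula n)) of
    provable T (a :: G) D : provable T G (Neg a :: D)
| p_impL n a b (G D : seq (formula n)) of
    provable T G (a :: D) & provable T (b :: G) D : provable T (Imp a b :: G) D
| p_impR n a b (G D : seq (formula n)) of
    provable T (a :: G) (b :: D) : provable T G (Imp a b :: D)
| p_context n (G D : seq (formula n)) of
    provable T G D : provable T (map (@weaken n) G) (map (@weaken n) D)
| p_allL n (t : term F n) a (G D : seq (formula n)) of
    provable T (inst t a :: G) D : provable T (All a :: G) D
| p_allR n a (G D : seq (formula n)) of
    provable T (map (@weaken n) G) (a :: map (@weaken n) D) :
    provable T G (All a :: D)
| p_exL n a (G D : seq (formula n)) of
    provable T (a :: map (@weaken n) G) (map (@weaken n) D) :
    provable T (Ex a :: G) D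
| p_exR n (t : term F n) a (G D : seq (formula n)) of
    provable T G (inst t a :: D) : provable T G (Ex a :: D).

Definition below (T : theory) n (a b : formula n) : Prop :=
  provable T [:: a] [:: b].

Lemma inst_up n m (s : 'I_n -> term F m) t a :
  fsub s (inst t a) = inst (tsub s t) (fsub (up s) a).
Proof.
rewrite /inst !fsub_fsub; congr fsub; apply: (scons_eq (t := tsub s t)).
- by rewrite scons_last.
- by rewrite /up scons_last /= scons_last.
move=> i; rewrite /up !scons_lift /= tsub_tsub -[LHS]tsub_var; congr tsub.
by apply: funext => j; rewrite /= scons_lift.
Qed.

Lemma fsub_weaken n m (s : 'I_n -> term F m) a :
  fsub (up s) (weaken a) = weaken (fsub s a).
Proof.
by rewrite /weaken !fsub_fsub; congr fsub; apply: funext => i; rewrite /= /up scons_lift.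
Qed.

Lemma map_fsub_weaken n m (s : 'I_n -> term F m) (G : seq (formula n)) :
  map (fsub (up s)) (map (@weaken n) G) = map (@weaken m) (map (fsub s) G).
Proof. by rewrite -!map_comp; apply: eq_map => a /=; rewrite fsub_weaken. Qed.

Lemma provable_axiom T (a : formula 0) m (s : 'I_0 -> term F m) :
  T a -> provable T [::] [:: fsub s a].
Proof.
move=> Ta; have Ea p (u v : 'I_0 -> term F p) : u = v by apply: funext => -[].
elim: m s => [|m IHm] s.
  by rewrite (Ea _ s (@Var F 0)) fsub_var; apply: p_axiom.
have /p_context /= := IHm (fun i => Var (widen_ord (leq0n m) i)).
by rewrite /weaken fsub_fsub; congr (provable T [::] [:: fsub _ a]); apply: Ea.
Qed.

Lemma provable_fsub T n (G D : seq (formula n)) m (s : 'I_n -> term F m) :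
  provable T G D -> provable T (map (fsub s) G) (map (fsub s) D).
Proof.
move=> GD; elim: GD m s => {n G D} /=.
- by move=> a Ta m s; apply: provable_axiom.
- by move=> *; apply: p_id.
- by move=> *; apply: p_weakL; auto.
- by move=> *; apply: p_weakR; auto.
- by move=> *; apply: p_contrL; auto.
- by move=> *; apply: p_contrR; auto.
- move=> n a b G G' D _ IH m s; have := IH m s.
  by rewrite !map_cat => /p_exchL.
- move=> n a b G D D' _ IH m s; have := IH m s.
  by rewrite !map_cat => /p_exchR.
- move=> n a G G' D D' _ IH1 _ IH2 m s; rewrite !map_cat.
  exact: p_cut (IH1 m s) (IH2 m s).
- by move=> *; apply: p_topL; auto.
- by move=> *; apply: p_topR.
- by move=> *; apply: p_botL.
- by move=> *; apply: p_botR; auto.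
- by move=> *; apply: p_andL1; auto.
- by move=> *; apply: p_andL2; auto.
- by move=> *; apply: p_andR; auto.
- by move=> *; apply: p_orL; auto.
- by move=> *; apply: p_orR1; auto.
- by move=> *; apply: p_orR2; auto.
- by move=> *; apply: p_negL; auto.
- by move=> *; apply: p_negR; auto.
- by move=> *; apply: p_impL; auto.
- by move=> *; apply: p_impR; auto.
- move=> n G D _ IH m s; have := IH m (fun i => s (lift ord_max i)).
  by congr provable; rewrite -map_comp; apply: eq_map => a /=;
    rewrite /weaken fsub_fsub.
- move=> n t a G D _ IH m s; apply: (@p_allL _ _ (tsub s t)).
  by rewrite -inst_up; apply: IH.
- move=> n a G D _ IH m s; apply: p_allR; have := IH m.+1 (up s).
  by rewrite /= !map_fsub_weaken.
- move=> n a G D _ IH m s; apply: p_exL; have := IH m.+1 (up s).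
  by rewrite /= !map_fsub_weaken.
- move=> n t a G D _ IH m s; apply: (@p_exR _ _ (tsub s t)).
  by rewrite -inst_up; apply: IH.
Qed.

Lemma below_fsub T n (a b : formula n) m (s : 'I_n -> term F m) :
  below T a b -> below T (fsub s a) (fsub s b).
Proof. exact: provable_fsub. Qed.

Lemma below_trans T n (b a c : formula n) :
  below T a b -> below T b c -> below T a c.
Proof. by move=> ab bc; have := p_cut ab bc. Qed.

Lemma below_and T n (a b c : formula n) :
  below T a (And b c) <-> below T a b /\ below T a c.
Proof.
split=> [abc|[ab ac]]; last exact: p_andR.
have idb := p_id T b; have idc := p_id T c.
by split; apply: (below_trans abc); [apply: p_andL1 | apply: p_andL2].
Qed.

Lemma below_or T n (a b c : formula n) :
  below T (Or a b) c <-> below T a c /\ below T b c.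
Proof.
split=> [abc|[ac bc]]; last exact: p_orL.
have ida := p_id T a; have idb := p_id T b.
by split; apply: (below_trans _ abc); [apply: p_orR1 | apply: p_orR2].
Qed.

Lemma below_all T n (a : formula n) b :
  below T a (All b) <-> below T (weaken a) b.
Proof.
split=> [ab|ab]; last by apply: p_allR.
apply: (below_trans (below_fsub (@wkv F n) ab)) => /=.
apply: (@p_allL _ _ (Var ord_max)).
rewrite /inst fsub_fsub fsub_id; first exact: p_id.
move=> i; case: (unliftP ord_max i) => [j|] ->; rewrite /up ?scons_lift ?scons_last /=.
  by rewrite scons_lift.
by rewrite scons_last.
Qed.

Lemma below_neg T n (a : formula n) :
  below T (And a (Neg a)) (Bot n) /\ below T (Top n) (Or a (Neg a)).
Proof.
split.
  apply: p_contrL; apply: p_andL1; apply: (p_exchL (G := [::])).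
  apply: p_andL2; apply: p_negL; apply: (p_exchR (D := [::])).
  exact/p_weakR/p_id.
apply: p_contrR; apply: p_orR2; apply: p_negR.
by apply: p_orR1; apply: (p_exchL (G := [::])); apply/p_weakL/p_id.
Qed.

Lemma below_distr T n (a b c : formula n) :
  below T (And (Or a b) c) (Or (And a c) (And b c)).
Proof.
apply: p_contrL; apply: p_andL1; apply: p_orL.
  apply: p_orR1; apply: p_andR; first by apply: (p_exchL (G := [::])); apply/p_weakL/p_id.
  by apply: p_weakL; apply: p_andL2; apply: p_id.
apply: p_orR2; apply: p_andR; first by apply: (p_exchL (G := [::])); apply/p_weakL/p_id.
by apply: p_weakL; apply: p_andL2; apply: p_id.
Qed.

Lemma below_cast T n m (e : n = m) (a b : formula n) :
  below T (fsub (castv e) a) (fsub (castv e) b) <-> below T a b.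
Proof.
split=> [/(below_fsub (castv (esym e)))|]; last exact: below_fsub.
by rewrite !fsub_fsub !fsub_id // => i; rewrite /= /castv cast_ordK.
Qed.

Lemma below_all_block T n m (a : formula n) (b : formula (n + m)) :
  below T a (all_block b) <-> below T (fsub (fun i => Var (lshift m i)) a) b.
Proof.
elim: m b => [|m IHm] b /=.
  rewrite -(below_cast T (addn0 n) _ b) fsub_fsub.
  by rewrite fsub_id // => i; congr Var; apply: val_inj.
rewrite IHm below_all -(below_cast T (addnS n m) _ b) /weaken !fsub_fsub.
suff -> : (fun i : 'I_n => tsub (@wkv F (n + m)) (Var (lshift m i))) =
  (fun i => tsub (castv (addnS n m)) (Var (lshift m.+1 i))) by [].
apply: funext => i; congr Var; apply: val_inj.
by rewrite /= /bump leqNgt ltn_addr.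
Qed.

Definition block_up n m p (s : 'I_n -> term F m) (i : 'I_(n + p)) : term F (m + p) :=
  match split i with
  | inl j => tsub (fun k => Var (lshift p k)) (s j)
  | inr k => Var (rshift m k)
  end.

Lemma fsub_all_block n m p (s : 'I_n -> term F m) (a : formula (n + p)) :
  fsub s (all_block a) = all_block (fsub (block_up s) a).
Proof.
elim: p a => [|p IHp] a /=.
  rewrite !fsub_fsub; congr fsub; apply: funext => i /=.
  rewrite /block_up; case: splitP => [j /= ij|[]//].
  rewrite /castv (_ : cast_ord _ _ = j) ?tsub_tsub; last exact: val_inj.
  rewrite -[LHS]tsub_var; congr tsub; apply: funext => k /=.
  by congr Var; apply: val_inj.
rewrite IHp /= !fsub_fsub; congr (all_block (All (fsub _ a))).
apply: funext => i /=; rewrite /castv /block_up.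
case: (splitP i) => [j ij|k ik] /=.
  rewrite (_ : cast_ord _ _ = lift ord_max (lshift p j)); last first.
    by apply: val_inj; rewrite /= /bump leqNgt ltn_addr.
  rewrite /up scons_lift; case: splitP => [j' /= jj'|k /= jk]; last first.
    by have := ltn_ord j; rewrite jk ltnNge leq_addr.
  rewrite !tsub_tsub (_ : j' = j); last exact: val_inj.
  congr tsub; apply: funext => k /=; congr Var; apply: val_inj.
  by rewrite /= /bump leqNgt ltn_addr.
have [kp|kp] := ltnP k p.
  rewrite (_ : cast_ord _ _ = lift ord_max (rshift n (Ordinal kp))); last first.
    by apply: val_inj; rewrite /= /bump leqNgt ltn_add2l kp.
  rewrite /up scons_lift; case: splitP => [j' /= jj'|k' /= kk'].
    by have := ltn_ord j'; rewrite -jj' ltnNge leq_addr.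
  have k'E : k = k' :> nat by apply/eqP; rewrite -(eqn_add2l n) -kk'.
  by congr Var; apply: val_inj; rewrite /= /bump leqNgt -k'E ltn_add2l kp.
have kE : k = p :> nat by apply/eqP; rewrite eqn_leq kp -ltnS ltn_ord.
rewrite (_ : cast_ord _ _ = ord_max); last by apply: val_inj; rewrite /= ik kE.
by rewrite /up scons_last; congr Var; apply: val_inj; rewrite /= kE.
Qed.
End Formulas.

Arguments formula F R n : clear implicits.
Arguments theory F R : clear implicits.

HB.instance Definition _ (F R : language) n := gen_eqMixin (formula F R n).
HB.instance Definition _ (F R : language) n := gen_choiceMixin (formula F R n).

Section Lindenbaum.
Context {F R : language} (T : theory F R).

Definition equivalent n : rel (formula F R n) :=
  fun a b => `[< below T a b /\ below T b a >].

Lemma equivalent_refl n : reflexive (@equivalent n).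
Proof. by move=> a; apply/asboolP; split; apply: p_id. Qed.

Lemma equivalent_sym n : symmetric (@equivalent n).
Proof. by move=> a b; apply/asboolP/asboolP => -[]. Qed.

Lemma equivalent_trans n : transitive (@equivalent n).
Proof.
move=> b a c /asboolP[ab ba] /asboolP[bc cb].
by apply/asboolP; split; [apply: below_trans ab bc | apply: below_trans cb ba].
Qed.

Canonical equivalent_equiv n := EquivRel (@equivalent n)
  (@equivalent_refl n) (@equivalent_sym n) (@equivalent_trans n).

Definition LT n := {eq_quot (@equivalent n)}%qT.

HB.instance Definition _ n := Choice.on (LT n).

Definition cls n (a : formula F R n) : LT n := \pi_(LT n)%qT a.
Definition rep n (x : LT n) : formula F R n := repr x.

Lemma repK n (x : LT n) : cls (rep x) = x.
Proof. exact: reprK. Qed.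

Lemma cls_surj n (x : LT n) : exists a, x = cls a.
Proof. by exists (rep x); rewrite repK. Qed.

Lemma clsP n (a b : formula F R n) : cls a = cls b <-> below T a b /\ below T b a.
Proof.
by split=> [/eqquotP/asboolP|ab]; last exact/eqquotP/asboolP.
Qed.

Lemma rep_cls n (a : formula F R n) : below T (rep (cls a)) a /\ below T a (rep (cls a)).
Proof. by apply/clsP; rewrite repK. Qed.

Definition LT_le n (x y : LT n) : bool := `[< below T (rep x) (rep y) >].

Lemma LT_le_cls n (a b : formula F R n) : LT_le (cls a) (cls b) = `[< below T a b >].
Proof.
have [ra ar] := rep_cls a; have [rb br] := rep_cls b.
by apply/asboolP/asboolP => ab; [apply: below_trans ar (below_trans ab rb)
                                | apply: below_trans ra (below_trans ab br)].
Qed.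

Lemma LT_le_refl n : reflexive (@LT_le n).
Proof. by move=> x; apply/asboolP/p_id. Qed.

Lemma LT_le_anti n : antisymmetric (@LT_le n).
Proof.
move=> x y /andP[/asboolP xy /asboolP yx].
by rewrite -[x]repK -[y]repK; apply/clsP.
Qed.

Lemma LT_le_trans n : transitive (@LT_le n).
Proof.
by move=> y x z /asboolP xy /asboolP yz; apply/asboolP; apply: below_trans xy yz.
Qed.

Fact LT_display : Order.disp_t. Proof. exact: Order.Disp tt tt. Qed.

HB.instance Definition _ n := Order.Le_isPOrder.Build LT_display (LT n)
  (@LT_le_refl n) (@LT_le_anti n) (@LT_le_trans n).

Lemma le_cls n (a b : formula F R n) : (cls a <= cls b) = `[< below T a b >].
Proof. exact: LT_le_cls. Qed.

Definition LT_meet n (x y : LT n) := cls (And (rep x) (rep y)).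
Definition LT_join n (x y : LT n) := cls (Or (rep x) (rep y)).

Lemma le_cls_and n x (a b : formula F R n) :
  (x <= cls (And a b)) = (x <= cls a) && (x <= cls b).
Proof.
by rewrite -[x]repK !le_cls -asbool_and; apply/asbool_equiv_eq/below_and.
Qed.

Lemma le_cls_or n x (a b : formula F R n) :
  (cls (Or a b) <= x) = (cls a <= x) && (cls b <= x).
Proof.
by rewrite -[x]repK !le_cls -asbool_and; apply/asbool_equiv_eq/below_or.
Qed.

Lemma LT_meetP n (x y z : LT n) : (x <= LT_meet y z) = (x <= y) && (x <= z).
Proof. by rewrite le_cls_and !repK. Qed.

Lemma LT_joinP n (x y z : LT n) : (LT_join x y <= z) = (x <= z) && (y <= z).
Proof. by rewrite le_cls_or !repK. Qed.

HB.instance Definition _ n := Order.POrder_MeetJoin_isLattice.Build LT_display (LT n)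
  (@LT_meetP n) (@LT_joinP n).

Lemma cls_and n (a b : formula F R n) : cls (And a b) = cls a `&` cls b.
Proof. by apply/eqP; rewrite eq_le lexI -le_cls_and lexx le_cls_and leIl leIr. Qed.

Lemma cls_or n (a b : formula F R n) : cls (Or a b) = cls a `|` cls b.
Proof. by apply/eqP; rewrite eq_le leUx -le_cls_or lexx le_cls_or leUl leUr. Qed.

Lemma LT_meetUl n : left_distributive (@Order.meet _ (LT n)) (@Order.join _ (LT n)).
Proof.
move=> x y z; apply/eqP; rewrite eq_le leUx !leI2 ?leUl ?leUr // !andbT.
case: (cls_surj x) (cls_surj y) (cls_surj z) => a -> [b ->] [c ->].
rewrite -(cls_or a b) -(cls_and a c) -(cls_and b c) -(cls_and (Or a b)).
by rewrite -(cls_or (And a c)) le_cls; apply/asboolP; apply: below_distr.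
Qed.

HB.instance Definition _ n := Order.Lattice_Meet_isDistrLattice.Build LT_display (LT n)
  (@LT_meetUl n).

Lemma LT_bot n (x : LT n) : cls (Bot n) <= x.
Proof. by rewrite -[x]repK le_cls; apply/asboolP/p_botL. Qed.

Lemma LT_top n (x : LT n) : x <= cls (Top n).
Proof. by rewrite -[x]repK le_cls; apply/asboolP/p_topR. Qed.

HB.instance Definition _ n := Order.hasBottom.Build LT_display (LT n) (@LT_bot n).
HB.instance Definition _ n := Order.hasTop.Build LT_display (LT n) (@LT_top n).

Definition LT_compl n (x : LT n) := cls (Neg (rep x)).

Lemma LT_joinxC n (x : LT n) : x `|` LT_compl x = \top.
Proof.
apply/eqP; rewrite -le1x -[x in x `|` _]repK -cls_or le_cls.
by apply/asboolP; have [] := below_neg T (rep x).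
Qed.

Lemma LT_meetxC n (x : LT n) : x `&` LT_compl x = \bot.
Proof.
apply/eqP; rewrite -lex0 -[x in x `&` _]repK -cls_and le_cls.
by apply/asboolP; have [] := below_neg T (rep x).
Qed.

HB.instance Definition _ n := Order.TBDistrLattice_hasComplement.Build LT_display (LT n)
  (@LT_joinxC n) (@LT_meetxC n).

Lemma cls_neg n (a : formula F R n) : cls (Neg a) = ~` (cls a).
Proof.
have [nb nt] := below_neg T a.
have b0 : cls a `&` cls (Neg a) = \bot.
  by apply/eqP; rewrite -lex0 -cls_and le_cls; apply/asboolP.
have b1 : cls a `|` cls (Neg a) = \top.
  by apply/eqP; rewrite -le1x -cls_or le_cls; apply/asboolP.
rewrite -[LHS]meet1x -(joinxC (cls a)) meetUl b0 join0x.
by rewrite -[RHS]meetx1 -b1 meetUr [_ `&` cls a]meetC meetxC join0x.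
Qed.

Lemma cls_imp n (a b : formula F R n) : cls (Imp a b) = cls (Or (Neg a) b).
Proof.
apply/clsP; split.
  apply: p_contrR; apply: p_orR1; apply: p_negR; apply: (p_exchL (G := [::])).
  apply: p_impL; first by apply: (p_exchR (D := [::])); apply/p_weakR/p_id.
  by apply: p_orR2; apply: (p_exchL (G := [::])); apply/p_weakL/p_id.
apply: p_impR; apply: (p_exchL (G := [::])); apply: p_orL.
  by apply: p_negL; apply: (p_exchR (D := [::])); apply/p_weakR/p_id.
by apply: (p_exchL (G := [::])); apply/p_weakL/p_id.
Qed.

Definition LT_BA n : boolAlg := BoolAlg (LT n).

Definition LT_sub n m (s : 'I_n -> term F m) (x : LT n) : LT m :=
  cls (fsub s (rep x)).

Lemma LT_sub_cls n m (s : 'I_n -> term F m) a : LT_sub s (cls a) = cls (fsub s a).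
Proof. by apply/clsP; have [ra ar] := rep_cls a; split; apply: below_fsub. Qed.

Lemma LT_sub_and n m (s : 'I_n -> term F m) : {morph LT_sub s : x y / x `&` y}.
Proof.
move=> x y; case: (cls_surj x) (cls_surj y) => a -> [b ->].
by rewrite -cls_and !LT_sub_cls -cls_and.
Qed.

Lemma LT_sub_or n m (s : 'I_n -> term F m) : {morph LT_sub s : x y / x `|` y}.
Proof.
move=> x y; case: (cls_surj x) (cls_surj y) => a -> [b ->].
by rewrite -cls_or !LT_sub_cls -cls_or.
Qed.

Lemma LT_sub_neg n m (s : 'I_n -> term F m) : {morph LT_sub s : x / ~` x}.
Proof. by move=> x; case: (cls_surj x) => a ->; rewrite -cls_neg !LT_sub_cls -cls_neg. Qed.

Definition LT_subst n m (s : 'I_n -> term F m) : bool_hom (LT_BA n) (LT_BA m) :=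
  @BoolHom (LT_BA n) (LT_BA m) (LT_sub s) (LT_sub_and s) (LT_sub_or s)
    (LT_sub_neg s) (LT_sub_cls s (Bot n)) (LT_sub_cls s (Top n)).

Lemma LT_sub_id n (x : LT n) : LT_sub (@Var F n) x = x.
Proof. by case: (cls_surj x) => a ->; rewrite LT_sub_cls fsub_var. Qed.

Lemma LT_sub_sub n m p (s : 'I_n -> term F m) (u : 'I_m -> term F p) (x : LT n) :
  LT_sub u (LT_sub s x) = LT_sub (fun i => tsub u (s i)) x.
Proof. by case: (cls_surj x) => a ->; rewrite !LT_sub_cls fsub_fsub. Qed.

Definition LT_all n m (x : LT (n + m)) : LT n := cls (all_block (rep x)).

Lemma LT_allP n m (x : LT n) (y : LT (n + m)) :
  (x <= LT_all y) = (LT_sub (fun i => Var (lshift m i)) x <= y).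
Proof.
rewrite -[y in RHS]repK -[x]repK LT_sub_cls !le_cls.
exact/asbool_equiv_eq/below_all_block.
Qed.

Lemma LT_all_cls n m (a : formula F R (n + m)) :
  LT_all (cls a) = cls (all_block a).
Proof.
suff E x : (x <= LT_all (cls a)) = (x <= cls (all_block a)).
  by apply/eqP; rewrite eq_le -E lexx E lexx.
case: (cls_surj x) => b ->; rewrite LT_allP LT_sub_cls !le_cls.
by apply/esym/asbool_equiv_eq/below_all_block.
Qed.

Lemma LT_sub_all n m p (s : 'I_n -> term F m) (x : LT (n + p)) :
  LT_sub s (LT_all x) = LT_all (LT_sub (@block_up F n m p s) x).
Proof.
by case: (cls_surj x) => a ->; rewrite LT_all_cls !LT_sub_cls LT_all_cls fsub_all_block.
Qed.

(* y ranges over the formulas in contexts extending the given one by m more   *)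
(* variables, and LT_all quantifies over these m variables.                   *)
Fixpoint level k n : LT n -> Prop :=
  match k with
  | 0 => fun x => exists2 a, qfree a & x = cls a
  | k'.+1 => generated (fun x => exists m (y : LT (n + m)), level k' y /\ x = LT_all y)
  end.

Lemma level_closed k n : [/\ @level k n \bot, @level k n \top &
  forall x y : LT n, level k x -> level k y ->
    [/\ level k (x `&` y), level k (x `|` y) & level k (~` x)]].
Proof.
case: k => [|k] /=; split.
- by exists (Bot n).
- by exists (Top n).
- move=> _ _ [a qa ->] [b qb ->]; split.
  + by exists (And a b); rewrite ?cls_and //= qa.
  + by exists (Or a b); rewrite ?cls_or //= qa.
  + by exists (Neg a); rewrite ?cls_neg.
- exact: gen_bot.
- exact: gen_top.
- by move=> x y; split; [apply: gen_meet | apply: gen_join | apply: gen_compl].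
Qed.

Lemma level_sub k n m (s : 'I_n -> term F m) (x : LT n) :
  level k x -> level k (LT_sub s x).
Proof.
elim: k n m s x => [|k IHk] n m s x /=.
  by move=> [a qa ->]; exists (fsub s a); rewrite ?qfree_fsub ?LT_sub_cls.
elim=> {x} [_ [p [y [ly ->]]]|||x y _ lx _ ly|x y _ lx _ ly|x _ lx].
- rewrite LT_sub_all; apply: gen_in; exists p, (LT_sub (@block_up F n m p s) y).
  by split=> //; apply: IHk.
- by rewrite [LT_sub s _](bh1 (LT_subst s)); apply: gen_top.
- by rewrite [LT_sub s _](bh0 (LT_subst s)); apply: gen_bot.
- by rewrite LT_sub_and; apply: gen_meet.
- by rewrite LT_sub_or; apply: gen_join.
- by rewrite LT_sub_neg; apply: gen_compl.
Qed.

Lemma level_incl k n (x : LT n) : level k x -> level k.+1 x.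
Proof.
move=> lx; apply: gen_in.
exists 0, (LT_sub (castv (esym (addn0 n))) x); split; first exact: level_sub.
case: (cls_surj x) => a ->; rewrite LT_sub_cls LT_all_cls /= fsub_fsub fsub_id //.
by move=> i; rewrite /= /castv cast_ordKV.
Qed.

Definition level_pred k n : pred (LT n) := fun x => `[< level k x >].

Definition LTn k n := {x : LT n | level_pred k x}.

HB.instance Definition _ k n := SubChoice.on (LTn k n).

Definition mkLTn k n (x : LT n) (lx : level k x) : LTn k n :=
  exist (@level_pred k n) x (asboolT lx).

Lemma levelP k n (x : LTn k n) : level k (val x).
Proof. exact/asboolP/(valP x). Qed.

Lemma level_meet k n : Order.ClosedPredicates.meet_closed (@level_pred k n).
Proof.
move=> x y /asboolP lx /asboolP ly; apply/asboolP.
by have [_ _ /(_ x y lx ly)[]] := level_closed k n.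
Qed.

Lemma level_join k n : Order.ClosedPredicates.join_closed (@level_pred k n).
Proof.
move=> x y /asboolP lx /asboolP ly; apply/asboolP.
by have [_ _ /(_ x y lx ly)[]] := level_closed k n.
Qed.

Lemma level_compl k n (x : LT n) : level k x -> level k (~` x).
Proof. by move=> lx; have [_ _ /(_ x x lx lx)[]] := level_closed k n. Qed.

Lemma level_bot k n : \bot \in @level_pred k n.
Proof. by apply/asboolP; have [] := level_closed k n. Qed.

Lemma level_top k n : \top \in @level_pred k n.
Proof. by apply/asboolP; have [] := level_closed k n. Qed.

HB.instance Definition _ k n := Order.SubChoice_isTBSubLattice.Build
  LT_display (LT n) (@level_pred k n) LT_display (LTn k n)
  (@level_meet k n) (@level_join k n) (@level_bot k n) (@level_top k n).

Lemma LTn_meetUl k n : left_distributive (@Order.meet _ (LTn k n)) (@Order.join _ (LTn k n)).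
Proof. by move=> x y z; apply: val_inj; apply: meetUl. Qed.

HB.instance Definition _ k n := Order.Lattice_Meet_isDistrLattice.Build
  LT_display (LTn k n) (@LTn_meetUl k n).

Definition LTn_compl k n (x : LTn k n) : LTn k n := mkLTn (level_compl (levelP x)).

Lemma LTn_joinxC k n (x : LTn k n) : x `|` LTn_compl x = \top.
Proof. by apply: val_inj; apply: joinxC. Qed.

Lemma LTn_meetxC k n (x : LTn k n) : x `&` LTn_compl x = \bot.
Proof. by apply: val_inj; apply: meetxC. Qed.

HB.instance Definition _ k n := Order.TBDistrLattice_hasComplement.Build
  LT_display (LTn k n) (@LTn_joinxC k n) (@LTn_meetxC k n).

Definition LTn_BA k n : boolAlg := BoolAlg (LTn k n).

Lemma val_compl k n (x : LTn k n) : val (~` x) = ~` (val x).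
Proof. by []. Qed.

Definition LTn_subst k n m (s : 'I_n -> term F m) :
  bool_hom (LTn_BA k n) (LTn_BA k m).
Proof.
exists (fun x => mkLTn (level_sub s (levelP x))) => [x y|x y|x||]; apply: val_inj.
- exact: LT_sub_and.
- exact: LT_sub_or.
- exact: LT_sub_neg.
- exact: (bh0 (LT_subst s)).
- exact: (bh1 (LT_subst s)).
Defined.

Definition LTn_incl k n : bool_hom (LTn_BA k n) (LTn_BA k.+1 n).
Proof.
by exists (fun x => mkLTn (level_incl (levelP x))) => [x y|x y|x||]; apply: val_inj.
Defined.

Lemma level_all k n m (x : LT (n + m)) : level k x -> level k.+1 (LT_all x).
Proof. by move=> lx; apply: gen_in; exists m, x. Qed.

Definition LTn_all k n m (x : LTn k (n + m)) : LTn k.+1 n :=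
  mkLTn (level_all (levelP x)).

End Lindenbaum.

(* Variables are natural numbers. Since terms and formulas in a context refer *)
(* to its variables by position, they depend only on ctx_size.                *)
Record context := Context {
  ctx_size : nat;
  ctx_vars : ctx_size.-tuple nat;
  ctx_uniq : uniq ctx_vars }.

Definition ctx_nil : context := @Context 0 [tuple] isT.

Definition fresh (x : seq nat) (i : nat) : nat := ((\max_(j <- x) j).+1 + i)%N.

Lemma ctx_cat_uniq (x y : context) :
  uniq [tuple of ctx_vars x ++ map (fresh (ctx_vars x)) (ctx_vars y)].
Proof.
rewrite /= cat_uniq ctx_uniq map_inj_uniq ?ctx_uniq ?andbT /=; last first.
  by move=> i j /addnI.
apply/hasPn => _ /mapP[i _ ->]; apply/negP => /= ix.
have := @leq_bigmax_seq _ (ctx_vars x) xpredT id _ ix isT.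
by rewrite leqNgt ltnS leq_addr.
Qed.

Definition ctx_cat (x y : context) : context := Context (ctx_cat_uniq x y).

Section Ctx.
Context (F : language).

Definition ctx_hom (x y : context) := 'I_(ctx_size y) -> term F (ctx_size x).

Definition ctx_pairing (x y z : context) (f : ctx_hom z x) (g : ctx_hom z y) :
    ctx_hom z (ctx_cat x y) :=
  fun i => match split i with inl j => f j | inr k => g k end.

Definition Ctx : fpcat.
Proof.
exists context ctx_hom (fun x => @Var F (ctx_size x))
  (fun x y z g f i => tsub f (g i)) ctx_nil
  (fun x i => Var (widen_ord (leq0n _) i)) ctx_cat
  (fun x y i => Var (lshift (ctx_size y) i))
  (fun x y i => Var (rshift (ctx_size x) i))
  ctx_pairing.
- by [].
- by move=> x y f; apply: funext => i; rewrite tsub_var.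
- by move=> x y z w h g f; apply: funext => i; rewrite tsub_tsub.
- by move=> x f; apply: funext => -[].
- move=> x y z f g; apply: funext => i; rewrite /= /ctx_pairing.
  by rewrite -[lshift _ _]/(unsplit (inl i)) unsplitK.
- move=> x y z f g; apply: funext => i; rewrite /= /ctx_pairing.
  by rewrite -[rshift _ _]/(unsplit (inr i)) unsplitK.
- move=> x y z h; apply: funext => i; rewrite /= /ctx_pairing.
  by rewrite -{1}[i]splitK; case: split.
Defined.
End Ctx.

Section SyntacticDoctrine.
Context {F R : language} (T : theory F R).

Definition LT_doctrine (k : nat) : doctrine (Ctx F).
Proof.
exists (fun x : context => LTn_BA T k (ctx_size x))
  (fun x y (f : ctx_hom F x y) => LTn_subst T k f) => [x a|x y z g f a];
  apply: val_inj.
- exact: LT_sub_id.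
- by rewrite /= LT_sub_sub.
Defined.

Definition LT_incl (k : nat) : nat_trans (LT_doctrine k) (LT_doctrine k.+1).
Proof. by exists (fun x => LTn_incl T k (ctx_size x)) => x y f a; apply: val_inj. Defined.

Lemma times_id_block_up (x' x y : Ctx F) (f : Hom x' x) :
  times_id f y = @block_up F (ctx_size x) (ctx_size x') (ctx_size y) f.
Proof. by []. Qed.

Lemma LTn_generated k n (S : LT T n -> Prop) (S' : LTn T k n -> Prop) (x : LTn T k n) :
  (forall y, S y -> exists2 z, S' z & y = val z) ->
  generated S (val x) -> generated S' x.
Proof.
move=> SS' gx; suff [z gz /val_inj-> //] : exists2 z, generated S' z & val x = val z.
elim: gx => {x} [x /SS'[z Sz ->]|||x y _ [a ga ->] _ [b gb ->]
  |x y _ [a ga ->] _ [b gb ->]|x _ [a ga ->]].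
- by exists z; first exact: gen_in.
- by exists \top; first exact: gen_top.
- by exists \bot; first exact: gen_bot.
- by exists (a `&` b); first exact: gen_meet.
- by exists (a `|` b); first exact: gen_join.
- by exists (~` a); first exact: gen_compl.
Qed.

Lemma ctx_of_size n : exists x : context, ctx_size x = n.
Proof.
have u : uniq [tuple of iota 0 n] by rewrite /= iota_uniq.
by exists (Context u).
Qed.

Definition LT_step (k : nat) : qa_one_step (LT_doctrine k) (LT_doctrine k.+1).
Proof.
exists (LT_incl k) (fun x y : context => @LTn_all F R T k (ctx_size x) (ctx_size y)).
- by move=> x a b /(congr1 val) ab; apply: val_inj.
- by move=> x y b a; apply: LT_allP.
- by move=> x' x f y b; apply: val_inj; apply: LT_sub_all.
move=> x a; apply: LTn_generated (levelP a) => _ [m [y [ly ->]]].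
case: (ctx_of_size m) => c cm; case: _ / cm in y ly *.
by exists (LTn_all (mkLTn ly)) => //; exists c, (mkLTn ly).
Defined.

Definition LT_stratified : qa_stratified (Ctx F).
Proof. by exists LT_doctrine LT_step => n X Y b; apply: val_inj. Defined.
End SyntacticDoctrine.

(* Main.v *)
From mathcomp Require Import all_boot all_order.
From mathcomp Require Import generic_quotient boolp.
Require Import Defs.

(* Take the elements of P_0(x_1,...,x_n) as the n-ary predicate symbols and     *)
(* interpret formulas in the colimit of the P_k; the theory consists of all     *)
(* sentences interpreted as true. Soundness makes the interpretation defined on *)
(* the syntactic doctrine, and it is an embedding there because the universal   *)
(* closure of a -> b is an axiom whenever a is interpreted below b. Condition   *)
(* (3) on both sides shows by induction on k that LT_k is mapped onto P_k.      *)
(* The colimit is never formed: an element of it is represented by its images   *)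
(* in the P_k for all large k, and statements about it by eventual ones.        *)

Set Implicit Arguments.
Unset Strict Implicit.
Unset Printing Implicit Defensive.

Import Order.Theory.

Local Open Scope order_scope.

(** Since the one-step quantifiers commute with the injections, the colimit of the [P k] has
    universal quantifiers right adjoint to reindexing along projections ([le_lift_qall]) and stable
    under substitution ([all1_sub]), so it interprets first-order logic ([ev]). Provability from
    [true_sentences] is valid there ([soundness]), and an inequality of interpretations is provable
    because its universal closure is an axiom ([completeness]). So the Lindenbaum algebras embed in
    the colimit ([le_clsT]), and quantifiers agree because both are adjoint to the same reindexing
    ([names_qall]).

    It remains to match the levels. Quantifier-free formulas evaluate in [P 0], and each element of
    [P 0] is the value of an atomic formula; above that, both doctrines are generated by the
    quantified elements of the level below ([names_total], [names_onto]). Injectivity of the steps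
    makes the match one-to-one ([names_inj]). *)

(** * Boolean algebra and reindexing along isomorphisms *)

Section BooleanAlgebra.
Context {d : Order.disp_t} {A : ctbDistrLatticeType d}.

Lemma leIC (x y z : A) : (x `&` ~` y <= z) = (x <= y `|` z).
Proof. by rewrite -diffE leBLR. Qed.

Lemma leI_complU (x y z : A) : (x `&` y <= z) = (x <= ~` y `|` z).
Proof. by rewrite -{1}(complK y) leIC. Qed.

(** The algebraic form of the cut rule. *)
Lemma le_cut (a c c' e e' : A) :
  c <= a `|` e -> a `&` c' <= e' -> c `&` c' <= e `|` e'.
Proof.
move=> ca ac; rewrite leI_complU joinCA; apply: le_trans ca _.
rewrite leUx leUl andbT; apply: le_trans (leUr _ _).
by rewrite -leI_complU.
Qed.
End BooleanAlgebra.

Lemma bh_mono (A B : boolAlg) (h : bool_hom A B) : {homo h : x y / x <= y}.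
Proof. by move=> x y; rewrite !leEmeet -bhI => /eqP ->. Qed.

(** Used to move casts between contexts of equal size from the right of [<=] to the left, where they
    compose with other reindexings. *)
Lemma le_dmap_iso (C : fpcat) (P : doctrine C) (X Y : C) (f : Hom X Y)
    (g : Hom Y X) (a : P X) (b : P Y) :
  g ∘ f = idm X -> f ∘ g = idm Y -> (a <= dmap P f b) = (dmap P g a <= b).
Proof.
move=> gf fg; apply/idP/idP => /bh_mono.
  by move=> /(_ _ (dmap P g)); rewrite -dmap_cmp fg dmap_id.
by move=> /(_ _ (dmap P f)); rewrite -dmap_cmp gf dmap_id.
Qed.

(** * Statements that hold at all large levels *)

Definition eventually (Q : nat -> Prop) : Prop :=
  exists K, forall k, (K <= k)%N -> Q k.

Lemma eventually_from (K : nat) (Q : nat -> Prop) :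
  (forall k, (K <= k)%N -> Q k) -> eventually Q.
Proof. by exists K. Qed.

Lemma eventually_mono (K : nat) (Q Q' : nat -> Prop) :
  (forall k, (K <= k)%N -> Q k -> Q' k) -> eventually Q -> eventually Q'.
Proof.
move=> QQ' [K' HK']; exists (maxn K K') => k.
by rewrite geq_max => /andP[Kk /HK' /(QQ' _ Kk)].
Qed.

Lemma eventually_and (Q Q' : nat -> Prop) :
  eventually Q -> eventually Q' -> eventually (fun k => Q k /\ Q' k).
Proof.
move=> [K HK] [K' HK']; exists (maxn K K') => k.
by rewrite geq_max => /andP[/HK ? /HK' ?].
Qed.

(** * Transport of elements to higher levels *)

Section Lift.
Context {C : fpcat} (P : qa_stratified C).

(* \bot is a junk value for j < k.                                            *)
Fixpoint lift k X (a : P k X) (j : nat) : P j X :=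
  match j with
  | 0 => if @eqP _ k 0 is ReflectT e then ecast i (P i X) e a else \bot
  | j'.+1 => if @eqP _ k j'.+1 is ReflectT e then ecast i (P i X) e a
             else step P j' X (lift a j')
  end.

Lemma lift_id k X (a : P k X) : lift a k = a.
Proof. by case: k a => [|k] a /=; case: eqP => // e; rewrite eq_axiomK. Qed.

Lemma lift_succ k X (a : P k X) j : (k <= j)%N -> lift a j.+1 = step P j X (lift a j).
Proof. by move=> /= kj; case: eqP => // e; have := kj; rewrite [X in (X <= _)%N]e ltnn. Qed.

Lemma lift_ind k (Q : nat -> Prop) :
  Q k -> (forall j, (k <= j)%N -> Q j -> Q j.+1) -> forall j, (k <= j)%N -> Q j.
Proof.
move=> Qk QS; elim=> [|j IHj]; first by rewrite leqn0 => /eqP <-.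
by rewrite leq_eqVlt ltnS => /orP[/eqP <-|kj] //; apply/QS/IHj.
Qed.

Lemma liftI k X (a b : P k X) j : (k <= j)%N -> lift (a `&` b) j = lift a j `&` lift b j.
Proof.
by move: j; apply: lift_ind => [|j kj IH]; rewrite ?lift_id // !lift_succ // IH bhI.
Qed.

Lemma liftU k X (a b : P k X) j : (k <= j)%N -> lift (a `|` b) j = lift a j `|` lift b j.
Proof.
by move: j; apply: lift_ind => [|j kj IH]; rewrite ?lift_id // !lift_succ // IH bhU.
Qed.

Lemma liftC k X (a : P k X) j : (k <= j)%N -> lift (~` a) j = ~` lift a j.
Proof.
by move: j; apply: lift_ind => [|j kj IH]; rewrite ?lift_id // !lift_succ // IH bhC.
Qed.

Lemma lift0 k X j : (k <= j)%N -> lift (\bot : P k X) j = \bot.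
Proof.
by move: j; apply: lift_ind => [|j kj IH]; rewrite ?lift_id // !lift_succ // IH bh0.
Qed.

Lemma lift1 k X j : (k <= j)%N -> lift (\top : P k X) j = \top.
Proof.
by move: j; apply: lift_ind => [|j kj IH]; rewrite ?lift_id // !lift_succ // IH bh1.
Qed.

Lemma lift_inj k X j : (k <= j)%N -> injective (fun a : P k X => lift a j).
Proof.
move: j; apply: lift_ind => [|j kj IH] a b; rewrite ?lift_id // !lift_succ //.
by move=> /(incl_inj (q := step P j)) /IH.
Qed.

Lemma lift_dmap k X Y (f : Hom X Y) (a : P k Y) j :
  (k <= j)%N -> lift (dmap (P k) f a) j = dmap (P j) f (lift a j).
Proof.
move: j; apply: lift_ind => [|j kj IH]; rewrite ?lift_id // !lift_succ // IH.
by rewrite nt_nat.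
Qed.

(** The inequality is strict because the left-hand lift starts at level [k.+1] and is a default
    value at [k]. *)
Lemma lift_step k X (a : P k X) j : (k < j)%N -> lift (step P k X a) j = lift a j.
Proof.
move: j; apply: lift_ind => [|j kj IH].
  by rewrite lift_id lift_succ // lift_id.
by rewrite lift_succ // IH -lift_succ // ltnW.
Qed.

Lemma lift_qall k X Y (b : P k (X ⊗ Y)) j :
  (k <= j)%N -> lift (qall (step P k) b) j.+1 = qall (step P j) (lift b j).
Proof.
move: j; apply: lift_ind => [|j kj IH]; first by rewrite !lift_id.
by rewrite lift_succ // IH step_qall (lift_succ _ kj).
Qed.

(** Condition (1) carried to every level above [k]: the adjunction that the quantifier satisfies in
    the colimit. *)
Lemma le_lift_qall k X Y (b : P k (X ⊗ Y)) j (c : P j X) :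
  (k < j)%N -> (c <= lift (qall (step P k) b) j) = (dmap (P j) (pr1 X Y) c <= lift b j).
Proof. by case: j c => // j c kj; rewrite lift_qall // qallP -lift_succ. Qed.
End Lift.

(* The graph of an isomorphism over the identity functor; the conditions are    *)
(* symmetric in P and R, so that the inverse is obtained from the flipped graph. *)
Record correspondence (C : fpcat) (P R : qa_stratified C) := Correspondence {
  crel :> forall k X, P k X -> R k X -> Prop;
  crel_total : forall k X (a : P k X), exists b, crel a b;
  crel_onto : forall k X (b : R k X), exists a, crel a b;
  crel_fun : forall k X (a : P k X) b b', crel a b -> crel a b' -> b = b';
  crel_inj : forall k X (a a' : P k X) b, crel a b -> crel a' b -> a = a';
  crelI : forall k X (a a' : P k X) b b',
    crel a b -> crel a' b' -> crel (a `&` a') (b `&` b');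
  crelU : forall k X (a a' : P k X) b b',
    crel a b -> crel a' b' -> crel (a `|` a') (b `|` b');
  crelC : forall k X (a : P k X) b, crel a b -> crel (~` a) (~` b);
  crel0 : forall k X, crel (\bot : P k X) \bot;
  crel1 : forall k X, crel (\top : P k X) \top;
  crel_dmap : forall k X Y (f : Hom X Y) (a : P k Y) b,
    crel a b -> crel (dmap (P k) f a) (dmap (R k) f b);
  crel_step : forall k X (a : P k X) b,
    crel a b -> crel (step P k X a) (step R k X b);
  crel_qall : forall k X Y (a : P k (X ⊗ Y)) b,
    crel a b -> crel (qall (step P k) a) (qall (step R k) b) }.

Definition correspondence_flip (C : fpcat) (P R : qa_stratified C)
  (c : correspondence P R) : correspondence R P.
Proof.
exists (fun k X b a => c k X a b) => *.
- exact: crel_onto.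
- exact: crel_total.
- by apply: crel_inj; eassumption.
- by apply: crel_fun; eassumption.
- exact: crelI.
- exact: crelU.
- exact: crelC.
- exact: crel0.
- exact: crel1.
- exact: crel_dmap.
- exact: crel_step.
- exact: crel_qall.
Defined.

(** * From a correspondence to an isomorphism of doctrines *)

Section CorrespondenceMorphism.
Context {C : fpcat} {P R : qa_stratified C} (c : correspondence P R).

Definition cfun k X (a : P k X) : R k X := sval (cid (crel_total c a)).

Lemma cfunP k X (a : P k X) : c k X a (cfun a).
Proof. by rewrite /cfun; case: cid. Qed.

Lemma cfunE k X (a : P k X) b : c k X a b -> cfun a = b.
Proof. exact/crel_fun/cfunP. Qed.

Definition cfun_hom k X : bool_hom (P k X) (R k X).
Proof.
exists (@cfun k X) => [a b|a b|a||]; apply: cfunE.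
- by apply: crelI; apply: cfunP.
- by apply: crelU; apply: cfunP.
- by apply: crelC; apply: cfunP.
- exact: crel0.
- exact: crel1.
Defined.

Definition cfun_nat k : nat_trans (P k) (precomp (R k) (fp_functor_id C)).
Proof.
apply: (@NatTrans _ (P k) (precomp (R k) (fp_functor_id C)) (cfun_hom k)) => X Y f a.
by apply: cfunE; apply: crel_dmap; apply: cfunP.
Defined.

Definition cfun_morphism : qa_morphism P R.
Proof.
exists (fp_functor_id C) cfun_nat => [k X a|k X Y b b'].
  by apply: cfunE; apply: crel_step; apply: cfunP.
rewrite /comparison /= pair_pr dmap_id => ->.
by apply: cfunE; apply: crel_qall; apply: cfunP.
Defined.
End CorrespondenceMorphism.

Lemma cfun_flipK (C : fpcat) (P R : qa_stratified C) (c : correspondence P R)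
    k X (a : P k X) :
  cfun (correspondence_flip c) (cfun c a) = a.
Proof. by apply: cfunE; apply: cfunP. Qed.

Lemma nat_trans_ext (C : fpcat) (P R : doctrine C) (s t : nat_trans P R) :
  (forall X, s X =1 t X) -> s = t.
Proof.
case: s t => [s sn] [t tn] /= st.
have e : s = t by apply: functional_extensionality_dep => X; apply/bool_hom_ext/st.
by case: _ / e in tn *; congr NatTrans; apply: Prop_irrelevance.
Qed.

(** The functors are unpacked because a composite of identity functors and the identity functor
    agree on objects and arrows by conversion but differ in the proofs of the functor laws; proof
    irrelevance identifies these. *)
Lemma qa_morphism_ext (C D : fpcat) (P : qa_stratified C) (R : qa_stratified D)
    (fo : C -> D) (fm : forall X Y, Hom X Y -> Hom (fo X) (fo Y))
    i c p o i' c' p' o'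
    (M := @FPFunctor C D fo fm i c p o) (M' := @FPFunctor C D fo fm i' c' p' o')
    (m : forall n, nat_trans (P n) (precomp (R n) M))
    (m' : forall n, nat_trans (P n) (precomp (R n) M')) mi mq mi' mq' :
  (forall n X (a : P n X), m n X a = m' n X a) ->
  @QAMorphism C D P R M m mi mq = @QAMorphism C D P R M' m' mi' mq'.
Proof.
rewrite {}/M {}/M' in m m' mi mq mi' mq' *.
have ei := Prop_irrelevance i i'; case: _ / ei in m' mi' mq' *.
have ec := Prop_irrelevance c c'; case: _ / ec in m' mi' mq' *.
have ep := Prop_irrelevance p p'; case: _ / ep in m' mi' mq' *.
have eo := Prop_irrelevance o o'; case: _ / eo in m' mi' mq' *.
move=> mm'.
have em : m = m'.
  by apply: functional_extensionality_dep => n; apply: nat_trans_ext => X a; apply: mm'.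
by case: _ / em in mi' mq' mm' *; congr QAMorphism; apply: Prop_irrelevance.
Qed.

Lemma cfun_morphism_iso (C : fpcat) (P R : qa_stratified C) (c : correspondence P R) :
  qa_iso (cfun_morphism c).
Proof.
exists (cfun_morphism (correspondence_flip c)); split; apply: qa_morphism_ext.
  by move=> n X a; apply: cfun_flipK.
by move=> n X b; apply: (cfun_flipK (correspondence_flip c)).
Qed.

(** * Interpretation of formulas *)

Section Semantics.
Context {F : language} (P : qa_stratified (Ctx F)).

(** Formulas are indexed by a number of variables, [P] by contexts: each length gets one
    representative, and the other contexts are reached through the isomorphisms [cast_hom]. *)
Definition std_ctx n : Ctx F := @Context n [tuple of iota 0 n] (iota_uniq 0 n).

Definition predicates : language :=
  @Language {n : nat & P 0%N (std_ctx n)} (fun r => tag r).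

Definition cast_hom (X Y : Ctx F) (e : ctx_size Y = ctx_size X) : Hom X Y := castv e.

Lemma cast_homK (X Y : Ctx F) (e : ctx_size Y = ctx_size X) (e' : ctx_size X = ctx_size Y) :
  cast_hom e' ∘ cast_hom e = idm X.
Proof. by apply: funext => i; congr Var; apply: val_inj. Qed.

Lemma le_dmap_cast (Q : doctrine (Ctx F)) (X Y : Ctx F) (e : ctx_size Y = ctx_size X)
    (a : Q X) (b : Q Y) :
  (a <= dmap Q (cast_hom e) b) = (dmap Q (cast_hom (esym e)) a <= b).
Proof. by apply: le_dmap_iso; apply: cast_homK. Qed.

Definition snoc_hom n : Hom (std_ctx n ⊗ std_ctx 1) (std_ctx n.+1) :=
  cast_hom (X := std_ctx n ⊗ std_ctx 1) (Y := std_ctx n.+1) (esym (addn1 n)).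
Arguments snoc_hom n : clear implicits.

(** Substitution under a binder is the product of [s] with an identity, seen through [snoc_hom];
    this turns condition (2) into [all1_sub]. *)
Lemma snoc_hom_up n m (s : @Hom (Ctx F) (std_ctx m) (std_ctx n)) :
  (up s : Hom (std_ctx m.+1) (std_ctx n.+1)) ∘ snoc_hom m =
  snoc_hom n ∘ times_id s (std_ctx 1).
Proof.
apply: funext => i /=; case: (unliftP ord_max i) => [j|] ->.
  rewrite /up scons_lift tsub_tsub /snoc_hom /cast_hom /castv.
  rewrite (_ : cast_ord _ _ = lshift 1 j); last first.
    by apply: val_inj; rewrite /= /bump leqNgt ltn_ord.
  rewrite /ctx_pairing /= -[lshift _ _]/(unsplit (inl j)) unsplitK.
  congr tsub; apply: funext => k /=; congr Var; apply: val_inj.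
  by rewrite /= /bump leqNgt ltn_ord.
rewrite /up scons_last /= /snoc_hom /cast_hom /castv (_ : cast_ord _ _ = rshift n ord0); last first.
  by apply: val_inj; rewrite /= addn0.
rewrite /ctx_pairing -[rshift _ _]/(unsplit (inr ord0)) unsplitK.
by congr Var; apply: val_inj; rewrite /= addn0.
Qed.

Definition all1 k n (b : P k (std_ctx n.+1)) : P k.+1 (std_ctx n) :=
  qall (step P k) (dmap (P k) (snoc_hom n) b).

Lemma all1_step k n (b : P k (std_ctx n.+1)) :
  step P k.+1 (std_ctx n) (all1 b) = all1 (step P k (std_ctx n.+1) b).
Proof. by rewrite /all1 step_qall nt_nat. Qed.

Lemma all1_sub k n m (s : @Hom (Ctx F) (std_ctx m) (std_ctx n)) (b : P k (std_ctx n.+1)) :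
  dmap (P k.+1) s (all1 b) =
  all1 (dmap (P k) (up s : Hom (std_ctx m.+1) (std_ctx n.+1)) b).
Proof. by rewrite /all1 qall_BC -!dmap_cmp snoc_hom_up. Qed.

Definition wk_hom n : @Hom (Ctx F) (std_ctx n.+1) (std_ctx n) := @wkv F n.
Arguments wk_hom n : clear implicits.

Lemma le_all1 k n (b : P k (std_ctx n.+1)) (c : P k.+1 (std_ctx n)) :
  (c <= all1 b) = (dmap (P k.+1) (wk_hom n) c <= step P k (std_ctx n.+1) b).
Proof.
rewrite /all1 qallP nt_nat le_dmap_cast -dmap_cmp.
congr (dmap _ _ c <= _); apply: funext => i.
by congr Var; apply: val_inj; rewrite /= /bump leqNgt ltn_ord.
Qed.

(* Meaningful only for k >= depth a, where it is stable in k by ev_succ.      *)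
Fixpoint ev n (a : formula F predicates n) : forall k, P k (std_ctx n) :=
  match a in formula _ _ n return forall k, P k (std_ctx n) with
  | Rel n r ts =>
      lift (@dmap _ (P 0%N) (std_ctx n) (std_ctx (tag r)) ts (tagged r))
  | Top n => fun=> \top
  | Bot n => fun=> \bot
  | And n a b => fun k => ev a k `&` ev b k
  | Or n a b => fun k => ev a k `|` ev b k
  | Neg n a => fun k => ~` ev a k
  | Imp n a b => fun k => ~` ev a k `|` ev b k
  | All n a => fun k => if k is j.+1 then all1 (ev a j) else \bot
  | Ex n a => fun k => if k is j.+1 then ~` all1 (~` ev a j) else \bot
  end.

(** Only an upper bound for the level of the value: quantifiers are counted one by one, whereas a
    whole block raises the level of a doctrine by one. *)
Fixpoint depth n (a : formula F predicates n) : nat :=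
  match a with
  | Rel _ _ _ | Top _ | Bot _ => 0
  | And _ a b | Or _ a b | Imp _ a b => maxn (depth a) (depth b)
  | Neg _ a => depth a
  | All _ a | Ex _ a => (depth a).+1
  end.

Lemma ev_succ n (a : formula F predicates n) k :
  (depth a <= k)%N -> ev a k.+1 = step P k (std_ctx n) (ev a k).
Proof.
elim: a k => {n} [n r ts|n|n|n a IHa b IHb|n a IHa b IHb|n a IHa|n a IHa b IHb
  |n a IHa|n a IHa] k.
- by move=> _; rewrite [ev _]/=; apply: lift_succ.
- by rewrite bh1.
- by rewrite bh0.
- by rewrite geq_max => /andP[ak bk]; rewrite /= IHa ?IHb ?bhI.
- by rewrite geq_max => /andP[ak bk]; rewrite /= IHa ?IHb ?bhU.
- by move=> ak; rewrite /= IHa ?bhC.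
- by rewrite geq_max => /andP[ak bk]; rewrite /= IHa ?IHb ?bhU ?bhC.
- by case: k => // k ak; rewrite all1_step -IHa.
- by case: k => // k ak; rewrite bhC all1_step bhC -IHa.
Qed.

(** At levels below the depth the equation also covers the default value [\bot], which reindexing
    preserves. *)
Lemma ev_sub n m (s : @Hom (Ctx F) (std_ctx m) (std_ctx n))
    (a : formula F predicates n) k :
  ev (fsub s a) k = dmap (P k) s (ev a k).
Proof.
elim: a m s k => {n} [n r ts|n|n|n a IHa b IHb|n a IHa b IHb|n a IHa|n a IHa b IHb
  |n a IHa|n a IHa] m s k /=.
- by rewrite -lift_dmap // -dmap_cmp.
- by rewrite bh1.
- by rewrite bh0.
- by rewrite IHa IHb bhI.
- by rewrite IHa IHb bhU.
- by rewrite IHa bhC.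
- by rewrite IHa IHb bhU bhC.
- by case: k => [|k]; rewrite ?bh0 // (IHa m.+1 (up s)) all1_sub.
- by case: k => [|k]; rewrite ?bh0 // (IHa m.+1 (up s)) bhC all1_sub bhC.
Qed.

Lemma le_ev_all n (a : formula F predicates n.+1) k (c : P k (std_ctx n)) :
  (depth a < k)%N -> (c <= ev (All a) k) = (dmap (P k) (wk_hom n) c <= ev a k).
Proof. by case: k c => // k c ak; rewrite le_all1 -ev_succ. Qed.

Lemma ev_ex n (a : formula F predicates n.+1) k :
  (0 < k)%N -> ev (Ex a) k = ~` ev (All (Neg a)) k.
Proof. by case: k. Qed.

Definition block_hom n m : @Hom (Ctx F) (std_ctx (n + m)) (std_ctx n) :=
  fun i => Var (lshift m i).
Arguments block_hom n m : clear implicits.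

(** The block composes [m] one-variable adjunctions, each asking for a level above the depth of its
    body; hence a statement about large levels. *)
Lemma le_ev_all_block n m (a : formula F predicates (n + m)) :
  eventually (fun k => forall c : P k (std_ctx n),
    (c <= ev (all_block a) k) = (dmap (P k) (block_hom n m) c <= ev a k)).
Proof.
elim: m a => [|m IHm] a.
  apply: (@eventually_from 0) => k _ c.
  rewrite (@ev_sub _ _ (cast_hom (X := std_ctx n) (Y := std_ctx (n + 0)) (addn0 n))).
  rewrite le_dmap_cast; congr (dmap _ _ c <= _).
  by apply: funext => i; congr Var; apply: val_inj.
have [K HK] := IHm (All (fsub (castv (addnS n m)) a)).
apply: (@eventually_from (maxn K (depth (fsub (castv (addnS n m)) a)).+1)) => k.
rewrite geq_max => /andP[/HK{}HK dk] c; rewrite HK le_ev_all //.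
rewrite (@ev_sub _ _
  (cast_hom (X := std_ctx (n + m).+1) (Y := std_ctx (n + m.+1)) (addnS n m))).
rewrite le_dmap_cast -!dmap_cmp; congr (dmap _ _ c <= _).
apply: funext => i; congr Var; apply: val_inj => /=.
by rewrite /bump leqNgt ltn_addr.
Qed.

(** The adjunction with side formulas, as needed for (R∀): [d] moves to the left as its complement,
    which reindexing preserves. *)
Lemma le_ev_allU n (a : formula F predicates n.+1) k (c d : P k (std_ctx n)) :
  (depth a < k)%N ->
  (c <= ev (All a) k `|` d) =
  (dmap (P k) (wk_hom n) c <= ev a k `|` dmap (P k) (wk_hom n) d).
Proof. by move=> ak; rewrite joinC [in RHS]joinC -!leIC le_ev_all // bhI bhC. Qed.

(** The counit of the adjunction [le_ev_all], reindexed along the section of [wk_hom n] determined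
    by [t]. *)
Lemma ev_all_inst n (t : term F n) (a : formula F predicates n.+1) k :
  (depth a < k)%N -> ev (All a) k <= ev (inst t a) k.
Proof.
move=> ak; pose s : @Hom (Ctx F) (std_ctx n) (std_ctx n.+1) := scons t (@Var F n).
rewrite (@ev_sub _ _ s); have : ev (All a) k <= ev (All a) k by [].
rewrite le_ev_all // => /(bh_mono (dmap (P k) s)).
rewrite -dmap_cmp (_ : wk_hom n ∘ s = idm _) ?dmap_id //.
by apply: funext => i; rewrite /= /s scons_lift.
Qed.

Lemma ev_inst_ex n (t : term F n) (a : formula F predicates n.+1) k :
  (depth a < k)%N -> ev (inst t a) k <= ev (Ex a) k.
Proof.
move=> ak; rewrite ev_ex ?(leq_ltn_trans _ ak) // lexC.
exact: (ev_all_inst t (a := Neg a)).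
Qed.

(** * Soundness *)

Definition antecedent n (G : seq (formula F predicates n)) k : P k (std_ctx n) :=
  \meet_(a <- G) ev a k.

Definition succedent n (D : seq (formula F predicates n)) k : P k (std_ctx n) :=
  \join_(a <- D) ev a k.

Lemma antecedent_cons n a (G : seq (formula F predicates n)) k :
  antecedent (a :: G) k = ev a k `&` antecedent G k.
Proof. exact: big_cons. Qed.

Lemma succedent_cons n a (D : seq (formula F predicates n)) k :
  succedent (a :: D) k = ev a k `|` succedent D k.
Proof. exact: big_cons. Qed.

Lemma antecedent_cat n (G G' : seq (formula F predicates n)) k :
  antecedent (G ++ G') k = antecedent G k `&` antecedent G' k.
Proof. exact: big_cat. Qed.

Lemma succedent_cat n (D D' : seq (formula F predicates n)) k :
  succedent (D ++ D') k = succedent D k `|` succedent D' k.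
Proof. exact: big_cat. Qed.

Lemma antecedent_weaken n (G : seq (formula F predicates n)) k :
  antecedent (map (@weaken F predicates n) G) k = dmap (P k) (wk_hom n) (antecedent G k).
Proof.
elim: G => [|a G IHG] /=; first by rewrite /antecedent !big_nil bh1.
by rewrite !antecedent_cons bhI IHG (@ev_sub _ _ (wk_hom n)).
Qed.

Lemma succedent_weaken n (D : seq (formula F predicates n)) k :
  succedent (map (@weaken F predicates n) D) k = dmap (P k) (wk_hom n) (succedent D k).
Proof.
elim: D => [|a D IHD] /=; first by rewrite /succedent !big_nil bh0.
by rewrite !succedent_cons bhU IHD (@ev_sub _ _ (wk_hom n)).
Qed.

Definition valid n (G D : seq (formula F predicates n)) : Prop :=
  eventually (fun k => antecedent G k <= succedent D k).

Definition true_sentences : theory F predicates :=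
  fun a => eventually (fun k => ev a k = \top).

(** Each rule is checked at a single level. Only the four quantifier rules bound that level from
    below, by the depth of the quantified formula; context enlargement is reindexing along
    [wk_hom]. *)
Lemma soundness n (G D : seq (formula F predicates n)) :
  provable true_sentences G D -> valid G D.
Proof.
have mono2 n1 (G1 D1 G2 D2 G3 D3 : seq (formula F predicates n1)) :
    (forall k, antecedent G1 k <= succedent D1 k -> antecedent G2 k <= succedent D2 k ->
      antecedent G3 k <= succedent D3 k) ->
    valid G1 D1 -> valid G2 D2 -> valid G3 D3.
  move=> H v1 v2; apply: (eventually_mono (K := 0)) (eventually_and v1 v2) => k _ [].
  exact: H.
elim=> {n G D}.
- by move=> a [K HK]; exists K => k /HK ak; rewrite succedent_cons ak join1x lex1.
- move=> n a; apply: (@eventually_from 0) => k _.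
  by rewrite antecedent_cons succedent_cons; apply: le_trans (leIl _ _) (leUl _ _).
- move=> n a G D _; apply: (eventually_mono (K := 0)) => k _; rewrite antecedent_cons.
  by apply: le_trans; apply: leIr.
- move=> n a G D _; apply: (eventually_mono (K := 0)) => k _ H; rewrite succedent_cons.
  by apply: le_trans H _; apply: leUr.
- by move=> n a G D _; apply: (eventually_mono (K := 0)) => k _; rewrite !antecedent_cons meetKI.
- by move=> n a G D _; apply: (eventually_mono (K := 0)) => k _; rewrite !succedent_cons joinKU.
- move=> n a b G G' D _; apply: (eventually_mono (K := 0)) => k _.
  by rewrite !antecedent_cat !antecedent_cons (meetCA (ev b k)).
- move=> n a b G D D' _; apply: (eventually_mono (K := 0)) => k _.
  by rewrite !succedent_cat !succedent_cons (joinCA (ev b k)).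
- move=> n a G G' D D' _ v1 _; apply: mono2 v1 => k.
  by rewrite succedent_cons antecedent_cons succedent_cat antecedent_cat; apply: le_cut.
- by move=> n G D _; apply: (eventually_mono (K := 0)) => k _; rewrite antecedent_cons meet1x.
- move=> n G D; apply: (@eventually_from 0) => k _.
  by rewrite succedent_cons join1x lex1.
- move=> n G D; apply: (@eventually_from 0) => k _.
  by rewrite antecedent_cons meet0x le0x.
- by move=> n G D _; apply: (eventually_mono (K := 0)) => k _; rewrite succedent_cons join0x.
- move=> n a b G D _; apply: (eventually_mono (K := 0)) => k _; rewrite !antecedent_cons.
  by apply: le_trans; rewrite leI2 // leIl.
- move=> n a b G D _; apply: (eventually_mono (K := 0)) => k _; rewrite !antecedent_cons.
  by apply: le_trans; rewrite leI2 // leIr.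
- move=> n a b G D _ v1 _; apply: mono2 v1 => k.
  by rewrite !succedent_cons /= joinIl lexI => -> ->.
- move=> n a b G D _ v1 _; apply: mono2 v1 => k.
  by rewrite !antecedent_cons /= meetUl leUx => -> ->.
- move=> n a b G D _; apply: (eventually_mono (K := 0)) => k _; rewrite !succedent_cons.
  by move=> H; apply: le_trans H _; rewrite leU2 // leUl.
- move=> n a b G D _; apply: (eventually_mono (K := 0)) => k _; rewrite !succedent_cons.
  by move=> H; apply: le_trans H _; rewrite leU2 // leUr.
- move=> n a G D _; apply: (eventually_mono (K := 0)) => k _.
  by rewrite succedent_cons antecedent_cons /= meetC leIC.
- move=> n a G D _; apply: (eventually_mono (K := 0)) => k _.
  by rewrite succedent_cons antecedent_cons /= meetC leI_complU.
- move=> n a b G D _ v1 _; apply: mono2 v1 => k.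
  rewrite succedent_cons !antecedent_cons /= meetUl leUx => aD -> /=.
  by rewrite andbT meetC leIC.
- move=> n a b G D _; apply: (eventually_mono (K := 0)) => k _.
  by rewrite !succedent_cons antecedent_cons /= meetC leI_complU joinA.
- move=> n G D _; apply: (eventually_mono (K := 0)) => k _ GD.
  by rewrite antecedent_weaken succedent_weaken; apply: bh_mono.
- move=> n t a G D _; apply: (eventually_mono (K := (depth a).+1)) => k ak.
  by rewrite !antecedent_cons; apply: le_trans; rewrite leI2 // ev_all_inst.
- move=> n a G D _; apply: (eventually_mono (K := (depth a).+1)) => k ak.
  by rewrite !succedent_cons antecedent_weaken succedent_weaken -le_ev_allU.
- move=> n a G D _; apply: (eventually_mono (K := (depth a).+1)) => k ak.
  (* Shifting complements across [<=] in premise and conclusion turns (L∃) for [a] into [le_ev_allU]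
     for [Neg a]. *)
  rewrite !antecedent_cons antecedent_weaken succedent_weaken ev_ex ?(leq_ltn_trans _ ak) //.
  by rewrite meetC leI_complU meetC leIC le_ev_allU.
- move=> n t a G D _; apply: (eventually_mono (K := (depth a).+1)) => k ak.
  by rewrite !succedent_cons => H; apply: le_trans H _; rewrite leU2 // ev_inst_ex.
Qed.

(** * Completeness and the embedding of the Lindenbaum algebras *)

Lemma completeness n (a b : formula F predicates n) :
  eventually (fun k => ev a k <= ev b k) -> below true_sentences a b.
Proof.
move=> ab.
have Tc : true_sentences (@all_block F predicates 0 n (Imp a b)).
  apply: (eventually_mono (K := 0)) (eventually_and ab (@le_ev_all_block 0 n (Imp a b))).
  (* By adjunction the closure has value [\top] as soon as [Imp a b] does, that is, as soon as
     [ev a k <= ev b k]. *)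
  move=> k _ [abk allk]; apply/eqP; rewrite -le1x allk bh1 -leI_complU meet1x.
  exact: abk.
(* [Top] supplies the left-hand formula that [below_all_block] expects, and the next cut removes it.
   The closure is opened by enlarging the context. *)
have /below_all_block /= := p_weakL (Top 0) (p_axiom Tc).
move=> /(p_cut (p_topR _ [::] [::])) /= ttab.
have abab : provable true_sentences [:: Imp a b; a] [:: b].
  apply: p_impL; last exact/(p_exchL (G := [::]))/p_weakL/p_id.
  exact/(p_exchR (D := [::]))/p_weakR/p_id.
exact: p_cut ttab abab.
Qed.

Local Notation LTT := (LT_stratified true_sentences).
Local Notation clsT := (cls true_sentences).

(** Sending the class of a formula to its value in the colimit is well defined by [soundness] and an
    order embedding by [completeness]. *)
Lemma le_clsT n (a b : formula F predicates n) :
  clsT a <= clsT b <-> eventually (fun k => ev a k <= ev b k).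
Proof.
rewrite le_cls; split=> [/asboolP/soundness|/completeness ab]; last exact/asboolP.
apply: (eventually_mono (K := 0)) => k _.
by rewrite antecedent_cons succedent_cons /antecedent /succedent !big_nil meetx1 joinx0.
Qed.

Lemma eq_clsT n (a b : formula F predicates n) :
  clsT a = clsT b <-> eventually (fun k => ev a k = ev b k).
Proof.
split=> [ab|ab].
  have /le_clsT leab : clsT a <= clsT b by rewrite ab.
  have /le_clsT leba : clsT b <= clsT a by rewrite ab.
  apply: (eventually_mono (K := 0)) (eventually_and leab leba) => k _ [abk bak].
  by apply/eqP; rewrite eq_le abk.
apply/eqP; rewrite eq_le; apply/andP.
by split; apply/le_clsT; apply: (eventually_mono (K := 0)) ab => k _ ->.
Qed.

(** * The correspondence with the syntactic doctrine *)

Definition std_hom (X : Ctx F) : Hom (std_ctx (ctx_size X)) X :=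
  cast_hom (X := std_ctx (ctx_size X)) (Y := X) erefl.
Arguments std_hom X : clear implicits.

Lemma std_homE X : std_hom X = @Var F (ctx_size X).
Proof. by apply: funext => i; rewrite /std_hom /cast_hom /castv cast_ord_id. Qed.

(** Equality of [f] and [a] in the colimit, after transport to the standard context. *)
Definition denotes k (X : Ctx F) (f : formula F predicates (ctx_size X)) (a : P k X) :=
  eventually (fun j => ev f j = dmap (P j) (std_hom X) (lift a j)).

(** The representative [f] may have any depth; that [x] lies in level [k] is recorded by its
    type. *)
Definition names k (X : Ctx F) (a : P k X) (x : LTT k X) : Prop :=
  exists2 f, val x = clsT f & denotes f a.

Lemma dmap_std_inj k (X : Ctx F) : injective (dmap (P k) (std_hom X)).
Proof.
pose g : Hom X (std_ctx (ctx_size X)) := cast_hom (Y := std_ctx (ctx_size X)) erefl.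
apply: (can_inj (g := dmap (P k) g)) => a.
by rewrite -dmap_cmp cast_homK dmap_id.
Qed.

Lemma names_fun k (X : Ctx F) (a : P k X) (x y : LTT k X) :
  names a x -> names a y -> x = y.
Proof.
move=> [f xf fa] [g yg ga]; apply: val_inj; rewrite xf yg; apply/eq_clsT.
by apply: (eventually_mono (K := 0)) (eventually_and fa ga) => k' _ [-> ->].
Qed.

(** The two elements agree at some level above [k], hence already at [k] by injectivity of the
    steps. *)
Lemma names_inj k (X : Ctx F) (a b : P k X) (x : LTT k X) :
  names a x -> names b x -> a = b.
Proof.
move=> [f xf fa] [g]; rewrite xf => /eq_clsT fg gb.
have [K HK] := eventually_and fg (eventually_and fa gb).
have [efg [efa egb]] := HK _ (leq_maxl K k).
apply: (@lift_inj _ P k X _ (leq_maxr K k)); apply: dmap_std_inj.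
by rewrite /= -efa -egb.
Qed.

Lemma namesI k (X : Ctx F) (a b : P k X) (x y : LTT k X) :
  names a x -> names b y -> names (a `&` b) (x `&` y).
Proof.
move=> [f xf fa] [g yg gb]; exists (And f g); first by rewrite cls_and -xf -yg.
apply: (eventually_mono (K := k)) (eventually_and fa gb) => j kj [fj gj].
by rewrite /= fj gj liftI ?bhI.
Qed.

Lemma namesU k (X : Ctx F) (a b : P k X) (x y : LTT k X) :
  names a x -> names b y -> names (a `|` b) (x `|` y).
Proof.
move=> [f xf fa] [g yg gb]; exists (Or f g); first by rewrite cls_or -xf -yg.
apply: (eventually_mono (K := k)) (eventually_and fa gb) => j kj [fj gj].
by rewrite /= fj gj liftU ?bhU.
Qed.

Lemma namesC k (X : Ctx F) (a : P k X) (x : LTT k X) :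
  names a x -> names (~` a) (~` x).
Proof.
move=> [f xf fa]; exists (Neg f); first by rewrite cls_neg -xf.
by apply: (eventually_mono (K := k)) fa => j kj fj; rewrite /= fj liftC ?bhC.
Qed.

Lemma names0 k (X : Ctx F) : names (\bot : P k X) \bot.
Proof.
exists (Bot _) => //; apply: (@eventually_from k) => j kj.
by rewrite lift0 // bh0.
Qed.

Lemma names1 k (X : Ctx F) : names (\top : P k X) \top.
Proof.
exists (Top _) => //; apply: (@eventually_from k) => j kj.
by rewrite lift1 // bh1.
Qed.

Lemma names_dmap k (X Y : Ctx F) (f : Hom X Y) (a : P k Y) (x : LTT k Y) :
  names a x -> names (dmap (P k) f a) (dmap (LTT k) f x).
Proof.
move=> [g xg ga]; exists (fsub f g); first by rewrite -LT_sub_cls -xg.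
apply: (eventually_mono (K := k)) ga => j kj gj.
pose f' : Hom (std_ctx (ctx_size X)) (std_ctx (ctx_size Y)) := f.
rewrite (@ev_sub _ _ f') gj lift_dmap // -!dmap_cmp; congr (dmap _ _ _).
by apply: funext => i; rewrite !std_homE /= tsub_var.
Qed.

Lemma names_step k (X : Ctx F) (a : P k X) (x : LTT k X) :
  names a x -> names (step P k X a) (step LTT k X x).
Proof.
move=> [f xf fa]; exists f => //.
by apply: (eventually_mono (K := k.+1)) fa => j kj fj; rewrite lift_step.
Qed.

(** At a large level both quantified elements have the same lower bounds [c], those whose reindexing
    along the projection lies below [b], so they are equal. *)
Lemma names_qall k (X Y : Ctx F) (b : P k (X ⊗ Y)) (y : LTT k (X ⊗ Y)) :
  names b y -> names (qall (step P k) b) (qall (step LTT k) y).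
Proof.
move=> [f yf fb]; exists (all_block f); first by rewrite /= yf LT_all_cls.
apply: (eventually_mono (K := k.+1)) (eventually_and fb (le_ev_all_block f)).
move=> j kj [fj allj]; suff E c :
    (c <= ev (all_block f) j) = (c <= dmap (P j) (std_hom X) (lift (qall (step P k) b) j)).
  by apply/eqP; rewrite eq_le -E lexx E lexx.
rewrite allj fj !le_dmap_cast le_lift_qall // -!dmap_cmp.
congr (dmap _ _ c <= _); apply: funext => i; congr Var; exact: val_inj.
Qed.

(** Condition (3) for [P] reduces level [k.+1] to level [k]; at level [0] the element is itself a
    predicate symbol. *)
Lemma names_total k (X : Ctx F) (a : P k X) : exists x : LTT k X, names a x.
Proof.
elim: k X a => [|k IHk] X a.
  (* The symbol is [a] moved to the standard context; applied to the variables in order, it denotes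
     [a]. *)
  pose r : predicates :=
    Tagged (fun n => P 0%N (std_ctx n)) (dmap (P 0%N) (std_hom X) a).
  pose f := @Rel F predicates (ctx_size X) r (@Var F (ctx_size X)).
  have l0 : level 0 (clsT f) by exists f.
  exists (mkLTn l0), f => //; apply: (@eventually_from 0) => j _.
  by rewrite -lift_dmap //; congr (lift _ j); apply: (dmap_id (d := P 0%N)).
elim: (qall_gen (step P k) a) => {a}
  [_ [Y [b ->]]|||a b _ [x ax] _ [y yb]|a b _ [x ax] _ [y yb]|a _ [x ax]].
- by have [y yb] := IHk _ b; exists (qall (step LTT k) y); apply: names_qall.
- by exists \top; apply: names1.
- by exists \bot; apply: names0.
- by exists (x `&` y); apply: namesI.
- by exists (x `|` y); apply: namesU.
- by exists (~` x); apply: namesC.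
Qed.

Lemma depth_qfree n (f : formula F predicates n) : qfree f -> depth f = 0.
Proof.
by elim: f => //= {}n f IHf g IHg /andP[/IHf -> /IHg ->].
Qed.

(** The same induction with condition (3) for the syntactic doctrine; a quantifier-free formula has
    depth [0], so its value at level [0] determines all later ones. *)
Lemma names_onto k (X : Ctx F) (x : LTT k X) : exists a : P k X, names a x.
Proof.
elim: k X x => [|k IHk] X x.
  have [f qf xf] := levelP x.
  pose s : Hom X (std_ctx (ctx_size X)) := @Var F (ctx_size X).
  exists (dmap (P 0%N) s (ev f 0)); exists f => //.
  apply: (@eventually_from 0) => j _; rewrite lift_dmap // -dmap_cmp std_homE.
  rewrite [_ ∘ _](_ : _ = idm (std_ctx (ctx_size X))) // dmap_id.
  elim: j => [|j IHj]; first by rewrite lift_id.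
  by rewrite lift_succ // -IHj ev_succ // depth_qfree.
elim: (qall_gen (step LTT k) x) => {x}
  [_ [Y [y ->]]|||x y _ [a ax] _ [b yb]|x y _ [a ax] _ [b yb]|x _ [a ax]].
- by have [b yb] := IHk _ y; exists (qall (step P k) b); apply: names_qall.
- by exists \top; apply: names1.
- by exists \bot; apply: names0.
- by exists (a `&` b); apply: namesI.
- by exists (a `|` b); apply: namesU.
- by exists (~` a); apply: namesC.
Qed.

Definition names_correspondence : correspondence P LTT := Correspondence
  names_total names_onto names_fun names_inj namesI namesU namesC names0 names1
  names_dmap names_step names_qall.
End Semantics.

Theorem theorem3p18 (F : language) (P : qa_stratified (Ctx F)) :
  exists (R : language) (T : theory F R)
         (M : qa_morphism P (LT_stratified T)), qa_iso M.
Proof.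
exists (predicates P), (@true_sentences F P), (cfun_morphism (names_correspondence P)).
exact: cfun_morphism_iso.
Qed.
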